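(* In the setting described in the context (with $I_{\mathrm{ra}}\ne\emptyset$), fix $\boldsymbol t_0\in(T_{\boldsymbol t})_{\boldsymbol t_{\mathrm{ra}}}$ and $\boldsymbol\theta\in T_{\boldsymbol\theta}$, and let $\omega$ be the $2$-form on $\mathcal M_{\boldsymbol t_0,\boldsymbol t_{\mathrm{ra}}}$ defined in the context by residues. Then $\omega$ coincides with $$\sum_{j=1}^{n-3}d\Big(\frac{p_j}{P(q_j)}\Big)\wedge dq_j .$$
   Context: **Setting.** Let $\nu\ge2$, $I=\{1,\dots,\nu,\infty\}$, $t_1=0$, $t_2=1$, $t_\infty=\infty\in\mathbb P^1$. Let $n_i\ge1$ ($i\in I$) be integers, $n=\sum_{i\in I}n_i$, and $I=I_{\mathrm{reg}}\sqcup I_{\mathrm{un}}\sqcup I_{\mathrm{ra}}$ with $n_i=1$ for $i\in I_{\mathrm{reg}}$, $n_i>1$ for $i\in I_{\mathrm{un}}\cup I_{\mathrm{ra}}$; assume $I_{\mathrm{ra}}\ne\emptyset$. Let $x$ be the affine coordinate on $U_0=\mathbb P^1\setminus\{\infty\}$, $w=1/x$ the coordinate on $U_\infty=\mathbb P^1\setminus\{0\}$; $x_{t_i}=x-t_i$ ($i\ne\infty$), $x_{t_\infty}=w$. Fix $\boldsymbol t_{\mathrm{ra}}=(t_i)_{i\in\{3,\dots,\nu\}\cap I_{\mathrm{ra}}}$, pairwise distinct and $\notin\{0,1\}$. $(T_{\boldsymbol t})_{\boldsymbol t_{\mathrm{ra}}}$ is the set of $(t_3,\dots,t_\nu)$ with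 pairwise distinct entries $\notin\{0,1\}$ whose entries with index in $I_{\mathrm{ra}}$ are the prescribed ones. $T_{\boldsymbol\theta}$ is the set of tuples $\boldsymbol\theta$ of complex numbers $\theta^\pm_{l,t_i}$ ($i\in I_{\mathrm{un}},0\le l\le n_i-2$), $\theta_{l',t_i}$ ($i\in I_{\mathrm{ra}},0\le l'\le 2n_i-3$) with $\theta^+_{0,t_i}\neq\theta^-_{0,t_i}$ ($i\in I_{\mathrm{un}}$), $\theta_{1,t_i}\ne0$ ($i\in I_{\mathrm{ra}}$). Fix constants $\boldsymbol\theta_0=((\theta^\pm_{n_i-1,t_i})_{i\in I_{\mathrm{reg}}\cup I_{\mathrm{un}}},(\theta_{2n_i-2,t_i})_{i\in I_{\mathrm{ra}}})$ with $\sum_{i\in I_{\mathrm{reg}}\cup I_{\mathrm{un}}}(\theta^+_{n_i-1,t_i}+\theta^-_{n_i-1,t_i})+\sum_{i\in I_{\mathrm{ra}}}(\theta_{2n_i-2,t_i}-\frac12)=-1$ and $\theta^+_{0,t_i}-\theta^-_{0,t_i}\notin\mathbb Z$ for $i\in I_{\mathrm{reg}}$. For $\boldsymbol t_0=(t_3,\dots,t_\nu)\in(T_{\boldsymbol t})_{\boldsymbol t_{\mathrm{ra}}}$, $\mathcal M_{\boldsymbol t_0,\boldsymbol t_{\mathrm{ra}}}$ is the set of $\{(q_1,p_1),\dots,(q_{n-3},p_{n-3})\}\in\mathrm{Sym}^{(n-3)}(\mathbb C^2)$ with the $q_j$ pairwise distinct and $q_j\notin\{0,1,t_3,\dots,t_\nu,\infty\}$.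 $P(x)=\prod_{i=1}^\nu(x-t_i)^{n_i}$. **Bundles, local data.** $E_k=\mathcal O_{\mathbb P^1}\oplus\mathcal O_{\mathbb P^1}(k)$ is given by trivializations on $U_0,U_\infty$ with transition matrix $G_k=\mathrm{diag}(1,x^k)$ from $U_\infty$ to $U_0$; a connection $d+\Omega$ on $U_0$ reads $d+G_k^{-1}dG_k+G_k^{-1}\Omega G_k$ on $U_\infty$. Local formal data at $t_i$ of a connection matrix $\Omega$ (the one on $U_\infty$ if $i=\infty$): for $i\in I_{\mathrm{reg}}\cup I_{\mathrm{un}}$, $(\theta^\pm_{l,t_i})_{0\le l\le n_i-1}$ if some $M\in GL_2(\mathbb C[[x_{t_i}]])$ gives $M^{-1}dM+M^{-1}\Omega M=\sum_{l=0}^{n_i-1}\mathrm{diag}(\theta^+_{l,t_i},\theta^-_{l,t_i})x_{t_i}^{-n_i+l}dx_{t_i}$; for $i\in I_{\mathrm{ra}}$, $(\theta_{l',t_i})_{0\le l'\le2n_i-2}$ if some such $M$ gives $M^{-1}dM+M^{-1}\Omega M=\begin{pmatrix}\alpha&\beta\\ x_{t_i}\beta&\alpha-\frac{dx_{t_i}}{2x_{t_i}}\end{pmatrix}$ with $\alpha=\sum_{l=0}^{n_i-1}\frac{\theta_{2l,t_i}}2x_{t_i}^{-n_i+l}dx_{t_i}$, $\beta=\sum_{l=0}^{n_i-2}\frac{\theta_{2l+1,t_i}}2x_{t_i}^{-n_i+l}dx_{t_i}$. **Normal form (Diarra–Loray).** For each point of $\mathcal M_{\boldsymbol t_0,\boldsymbol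 t_{\mathrm{ra}}}$ there is a unique connection $d+\Omega^{(n-2)}$ on $E_{n-2}$, with $\Omega^{(n-2)}=\begin{pmatrix}0&1/P(x)\\ c_0(x)&d_0(x)\end{pmatrix}dx$ on $U_0$, $$c_0=\sum_{i=1}^\nu\frac{C_i(x)}{(x-t_i)^{n_i}}+\sum_{j=1}^{n-3}\frac{p_j}{x-q_j}+\tilde C(x)+x^{n-3}C_\infty(x),\qquad d_0=\sum_{i=1}^\nu\frac{D_i(x)}{(x-t_i)^{n_i}}-\sum_{j=1}^{n-3}\frac1{x-q_j}+D_\infty(x),$$ polynomials $C_i,D_i,C_\infty,D_\infty,\tilde C$ with $\deg C_i,\deg D_i\le n_i-1$ ($i\le\nu$), $\deg C_\infty\le n_\infty-1$, $\deg D_\infty\le n_\infty-2$, $\deg\tilde C\le n-4$, such that (a) each $q_j$ is an apparent singularity, i.e. with $\tilde\Phi_{q_j}=\begin{pmatrix}1&0\\ p_j&x-q_j\end{pmatrix}$ the matrix $\tilde\Phi_{q_j}^{-1}d\tilde\Phi_{q_j}+\tilde\Phi_{q_j}^{-1}\Omega^{(n-2)}\tilde\Phi_{q_j}$ has no pole at $q_j$, and (b) its local formal data at every $t_i$ is given by $(\boldsymbol\theta,\boldsymbol\theta_0)$. Write $\Omega^{(n-2)}_\infty=G_{n-2}^{-1}dG_{n-2}+G_{n-2}^{-1}\Omega^{(n-2)}G_{n-2}$; at $i=\infty$ this matrix is used in place of $\Omega^{(n-2)}$ throughout. **Formal solutions, $i\in I_{\mathrm{reg}}\cup I_{\mathrm{un}}$.**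 Let $\Phi_i\in GL_2(\mathbb C)$, independent of the $(q_j,p_j)$, be such that $\Phi_i^{-1}\Omega^{(n-2)}\Phi_i$ has leading coefficient $\mathrm{diag}(\theta^+_{0,t_i},\theta^-_{0,t_i})$ of $x_{t_i}^{-n_i}dx_{t_i}$. There are unique functions $\theta^\pm_{l,t_i}$ ($l\ge n_i$) and a unique formal series $\Xi_i=\mathrm{id}+\sum_{s\ge1}\begin{pmatrix}0&*\\ *&0\end{pmatrix}x_{t_i}^s$ such that $\psi_i=\Phi_i\Xi_i\exp(-\Lambda_i)$, $\Lambda_i=\mathrm{diag}(\hat\lambda_i^+,\hat\lambda_i^-)$, $\hat\lambda_i^\pm=\sum_{l\ge0}\theta^\pm_{l,t_i}\int x_{t_i}^{-n_i+l}dx_{t_i}$, formally solves $(d+\Omega^{(n-2)})\psi_i=0$. **Formal solutions, $i\in I_{\mathrm{ra}}$.** Put $x_{t_i}=\zeta_i^2$, $M_{\zeta_i}=\begin{pmatrix}1&1\\ \zeta_i&-\zeta_i\end{pmatrix}$. A compatible framing $\Phi_i\in GL_2(\mathbb C)$ is a matrix, independent of the $(q_j,p_j)$, such that $\Phi_i^{-1}\Omega^{(n-2)}\Phi_i$ has leading coefficient $\begin{pmatrix}\theta_{0,t_i}/2&\theta_{1,t_i}/2\\ 0&\theta_{0,t_i}/2\end{pmatrix}$; take it such that there are (unique) functions $\theta_{l',t_i}$ ($l'\ge2n_i-1$) and a (unique) formal series $\Xi_i(x_{t_i})=\mathrm{id}+O(x_{t_i})$ with: (1) the gauge transform of $\Omega^{(n-2)}$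 by $\Phi_i\Xi_i$ is $\begin{pmatrix}\alpha_i&\beta_i\\ x_{t_i}\beta_i&\alpha_i-\frac{dx_{t_i}}{2x_{t_i}}\end{pmatrix}$ with $\alpha_i=\sum_{l\ge0}\frac{\theta_{2l,t_i}}2x_{t_i}^{-n_i+l}dx_{t_i}$, $\beta_i=\sum_{l\ge0}\frac{\theta_{2l+1,t_i}}2x_{t_i}^{-n_i+l}dx_{t_i}$; (2) $M_{\zeta_i}^{-1}\Xi_i(\zeta_i^2)M_{\zeta_i}=\begin{pmatrix}1&\zeta_i\xi(\zeta_i)\\ -\zeta_i\xi(-\zeta_i)&1\end{pmatrix}$ for some formal power series $\xi$. Put $\hat\lambda_{i,\pm}(\zeta_i)=\sum_{l'\ge0}(\pm1)^{l'}\theta_{l',t_i}\int\zeta_i^{-2n_i+l'+1}d\zeta_i$ and $\psi_{\zeta_i}=\Phi_i\Xi_i(\zeta_i^2)M_{\zeta_i}\exp(-\mathrm{diag}(\hat\lambda_{i,+},\hat\lambda_{i,-}))$, a formal solution of $(d+\Omega^{(n-2)}(\zeta_i^2))\psi_{\zeta_i}=0$, where $\Omega^{(n-2)}(\zeta_i^2)$ is the pull-back under $x_{t_i}=\zeta_i^2$. **Solutions at $q_j$.** $\psi_{q_j}=\begin{pmatrix}1&0\\ p_j&1\end{pmatrix}\Xi_{q_j}(x)\,\mathrm{diag}(1,x-q_j)$, with $\Xi_{q_j}$ a convergent power series in $x-q_j$, $\Xi_{q_j}(q_j)=\mathrm{id}$, is a fundamental solution of $(d+\Omega^{(n-2)})\psi_{q_j}=0$.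 **The 2-form $\omega$.** A vector field $\delta$ on $\mathcal M_{\boldsymbol t_0,\boldsymbol t_{\mathrm{ra}}}$ acts on matrices depending on $x$ (or $\zeta_i$) and the parameters with $x$ (or $\zeta_i$) fixed. Put $\delta(A)\wedge\delta(\psi)\psi^{-1}=\delta_1(A)\delta_2(\psi)\psi^{-1}-\delta_1(\psi)\psi^{-1}\delta_2(A)$ and $$\omega(\delta_1,\delta_2)=\tfrac12\sum_{i\in I\setminus I_{\mathrm{ra}}}\mathrm{res}_{x=t_i}\mathrm{Tr}\big(\delta(\Omega^{(n-2)})\wedge\delta(\psi_i)\psi_i^{-1}\big)+\tfrac14\sum_{i\in I_{\mathrm{ra}}}\mathrm{res}_{\zeta_i=0}\mathrm{Tr}\big(\delta(\Omega^{(n-2)}(\zeta_i^2))\wedge\delta(\psi_{\zeta_i})\psi_{\zeta_i}^{-1}\big)+\tfrac12\sum_{j=1}^{n-3}\mathrm{res}_{x=q_j}\mathrm{Tr}\big(\delta(\Omega^{(n-2)})\wedge\delta(\psi_{q_j})\psi_{q_j}^{-1}\big),$$ which is independent of the choices of solutions. *)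

(* Defs.v *)
From HB Require Import structures.
From mathcomp Require Import all_boot all_order all_algebra.
From mathcomp Require Import boolp classical_sets fsbigop reals topology normedtype sequences derive.
From mathcomp Require Import complex zify.
Set Implicit Arguments.
Unset Strict Implicit.
Unset Printing Implicit Defensive.
Import Order.TTheory GRing.Theory Num.Theory.
Import numFieldNormedType.Exports.
Local Open Scope classical_set_scope.
Local Open Scope ring_scope.

Definition bounded_below (K : fieldType) (f : int -> K) :=
  exists N : int, forall k, k < N -> f k = 0.

Record laurent (K : fieldType) :=
  Laurent { lcoef : int -> K; lcoef_bdd : bounded_below lcoef }.

Section LaurentField.
Variable K : fieldType.
Implicit Types (f g h : laurent K) (F G H : nat -> K) (a b : int).

Lemma laurentP f g : lcoef f = lcoef g -> f = g.
Proof.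
by case: f g => [f bf] [g bg] /= E; case: _ / E bg => bg; rewrite (Prop_irrelevance bf bg).
Qed.

HB.instance Definition _ := gen_eqMixin (laurent K).
HB.instance Definition _ := gen_choiceMixin (laurent K).

Definition shifted a F : int -> K := fun k => if a <= k then F `|k - a|%N else 0.

Definition conv F G : nat -> K := fun n => \sum_(i < n.+1) F i * G (n - i)%N.

Lemma shiftedE a F (n : nat) : shifted a F (a + n%:Z) = F n.
Proof. by rewrite /shifted lerDl /= (addrC a) addrK. Qed.

Lemma shifted_bdd a F : bounded_below (shifted a F).
Proof. by exists a => k; rewrite /shifted ltNge => /negbTE ->. Qed.

Lemma bdd_shifted (f : int -> K) a :
  (forall k, k < a -> f k = 0) -> f = shifted a (fun n => f (a + n%:Z)).
Proof.
move=> f0; apply/funext => k; rewrite /shifted; case: leP => ak; last exact: f0.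
by congr f; lia.
Qed.

Lemma shiftP f : exists a F, lcoef f = shifted a F.
Proof.
by have [a /bdd_shifted fE] := lcoef_bdd f; exists a, (fun n => lcoef f (a + n%:Z)).
Qed.

Lemma shiftP2 f g : exists a F G, lcoef f = shifted a F /\ lcoef g = shifted a G.
Proof.
have [[a fa] [b gb]] := (lcoef_bdd f, lcoef_bdd g).
exists (Num.min a b), (fun n => lcoef f (Num.min a b + n%:Z)),
  (fun n => lcoef g (Num.min a b + n%:Z)).
by split; apply: bdd_shifted => k; rewrite lt_min => /andP[? ?]; [apply: fa | apply: gb].
Qed.

Definition mulc (f g : int -> K) : int -> K :=
  fun k => \sum_(i \in [set: int]) (f i * g (k - i)).

Lemma mulc_shifted a b F G :
  mulc (shifted a F) (shifted b G) = shifted (a + b) (conv F G).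
Proof.
apply/funext => k; rewrite /mulc [RHS]/shifted; case: (leP (a + b) k) => abk; last first.
  apply: fsbig1 => i _; rewrite /shifted; case: (leP a i) => ai; last by rewrite mul0r.
  by case: (leP b (k - i)) => bi; [lia | rewrite mulr0].
set n := absz (k - (a + b))%R.

pose s : seq int := [seq (a + i%:Z)%R | i <- iota 0 n.+1].
have us : uniq s by rewrite map_inj_uniq ?iota_uniq // => x y; lia.
have s0 i : [set: int] i -> i \notin s -> shifted a F i * shifted b G (k - i) = 0.
  move=> _ /mapP iN; rewrite /shifted; case: (leP a i) => ai; last by rewrite mul0r.
  case: (leP b (k - i)) => bi; last by rewrite mulr0.
  by case: iN; exists (absz (i - a)%R); [rewrite mem_iota /n; lia | lia].
rewrite (fsbigE s _ us _ s0) //.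
under eq_bigl do rewrite in_setT.
rewrite big_map /conv -(big_mkord xpredT (fun i => F i * G (n - i)%N)) /index_iota subn0.
rewrite !big_seq; apply: eq_bigr => i; rewrite mem_iota add0n => /andP[_ ilt].
rewrite shiftedE; congr (_ * _).
by rewrite -(shiftedE b); congr shifted; rewrite /n; lia.
Qed.

Lemma addc_bdd f g : bounded_below (fun k => lcoef f k + lcoef g k).
Proof.
have [a [F [G [-> ->]]]] := shiftP2 f g.
by exists a => k ka; rewrite /shifted leNgt ka addr0.
Qed.
Lemma oppc_bdd f : bounded_below (fun k => - lcoef f k).
Proof. by have [a f0] := lcoef_bdd f; exists a => k /f0 ->; rewrite oppr0. Qed.
Lemma zeroc_bdd : bounded_below (fun _ => 0 : K).
Proof. by exists 0. Qed.
Lemma onec_bdd : bounded_below (fun k => (k == 0)%:R : K).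
Proof. by exists 0 => k k0; rewrite lt_eqF. Qed.
Lemma mulc_bdd f g : bounded_below (mulc (lcoef f) (lcoef g)).
Proof.
have [[a [F ->]] [b [G ->]]] := (shiftP f, shiftP g).
by rewrite mulc_shifted; apply: shifted_bdd.
Qed.

Definition ladd f g := Laurent (addc_bdd f g).
Definition lopp f := Laurent (oppc_bdd f).
Definition lzero := Laurent zeroc_bdd.
Definition lone := Laurent onec_bdd.
Definition lmul f g := Laurent (mulc_bdd f g).

Lemma laddA : associative ladd.
Proof. by move=> f g h; apply: laurentP; apply/funext => k /=; rewrite addrA. Qed.
Lemma laddC : commutative ladd.
Proof. by move=> f g; apply: laurentP; apply/funext => k /=; rewrite addrC. Qed.
Lemma ladd0 : left_id lzero ladd.
Proof. by move=> f; apply: laurentP; apply/funext => k /=; rewrite add0r. Qed.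
Lemma laddN : left_inverse lzero lopp ladd.
Proof. by move=> f; apply: laurentP; apply/funext => k /=; rewrite addNr. Qed.

HB.instance Definition _ := GRing.isZmodule.Build (laurent K) laddA laddC ladd0 laddN.

Lemma conv_poly n F G i : (i < n)%N ->
  conv F G i = ((\poly_(j < n) F j) * (\poly_(j < n) G j))`_i.
Proof.
move=> ni; rewrite coefM; apply: eq_bigr => j _; rewrite !coef_poly.
by rewrite !ifT //; have := ltn_ord j; lia.
Qed.

Lemma convA F G H : conv F (conv G H) = conv (conv F G) H.
Proof.
apply/funext => k; rewrite !(@conv_poly k.+1) //.
set p := \poly_(j < k.+1) F j; set q := \poly_(j < k.+1) G j.
set r := \poly_(j < k.+1) H j.
transitivity ((p * (q * r))`_k).
  rewrite !coefM; apply: eq_bigr => j _; congr (_ * _).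
  by rewrite coef_poly ifT -?conv_poly //; have := ltn_ord j; lia.
rewrite mulrA [LHS]coefM [RHS]coefM; apply: eq_bigr => j _; congr (_ * _).
by rewrite coef_poly ifT -?conv_poly //; have := ltn_ord j; lia.
Qed.

Lemma convC F G : conv F G = conv G F.
Proof. by apply/funext => k; rewrite !(@conv_poly k.+1) // mulrC. Qed.

Lemma lmulA : associative lmul.
Proof.
move=> f g h; apply: laurentP => /=.
have [[[a [F ->]] [b [G ->]]] [c [H ->]]] := (shiftP f, shiftP g, shiftP h).
by rewrite !mulc_shifted convA addrA.
Qed.

Lemma lmulC : commutative lmul.
Proof.
move=> f g; apply: laurentP => /=.
have [[a [F ->]] [b [G ->]]] := (shiftP f, shiftP g).
by rewrite !mulc_shifted convC addrC.
Qed.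

Lemma lone_shifted : lcoef lone = shifted 0 (fun n => (n == 0%N)%:R).
Proof.
apply/funext => k; rewrite /shifted /=; case: leP => k0; last by rewrite lt_eqF.
by rewrite subr0 absz_eq0.
Qed.

Lemma lmul1 : left_id lone lmul.
Proof.
move=> f; apply: laurentP; have [a [F fE]] := shiftP f.
rewrite -[LHS]/(mulc (lcoef lone) (lcoef f)) lone_shifted fE mulc_shifted add0r; congr shifted.
apply/funext => n; rewrite /conv big_ord_recl mul1r subn0 big1 ?addr0 //.
by move=> i _; rewrite mul0r.
Qed.

Lemma lmulDl : left_distributive lmul ladd.
Proof.
move=> f g h; apply: laurentP => /=.
have [a [F [G [fE gE]]]] := shiftP2 f g; have [b [H ->]] := shiftP h.
have -> : (fun k => lcoef f k + lcoef g k) = shifted a (fun n => F n + G n).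
  by apply/funext => k; rewrite fE gE /shifted; case: ifP; rewrite ?addr0.
rewrite fE gE !mulc_shifted; apply/funext => k; rewrite /shifted; case: ifP => _.
  by rewrite /conv -big_split; apply: eq_bigr => i _; rewrite mulrDl.
by rewrite addr0.
Qed.

Lemma lone_neq0 : lone != 0.
Proof.
by apply/eqP => /(congr1 (fun f => lcoef f 0)) /= /eqP; rewrite oner_eq0.
Qed.

HB.instance Definition _ :=
  GRing.Zmodule_isComNzRing.Build (laurent K) lmulA lmulC lmul1 lmulDl lone_neq0.

Fixpoint ginv_seq F n : seq K :=
  if n is m.+1 then
    let s := ginv_seq F m in
    rcons s ((F 0%N)^-1 * ((m == 0%N)%:R - \sum_(i < m) F i.+1 * nth 0 s (m - i.+1)%N))
  else [::].

Lemma size_ginv F n : size (ginv_seq F n) = n.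
Proof. by elim: n => //= n IH; rewrite size_rcons IH. Qed.

Lemma nth_ginv F n i : (i < n)%N -> nth 0 (ginv_seq F n) i = nth 0 (ginv_seq F i.+1) i.
Proof.
elim: n => // n IH; rewrite ltnS leq_eqVlt => /orP[/eqP -> //|lt_in].
by rewrite [LHS]/= nth_rcons size_ginv lt_in IH.
Qed.

Lemma conv_inv F : F 0%N != 0 -> exists G, conv F G = fun n => (n == 0%N)%:R.
Proof.
move=> F0; exists (fun n => nth 0 (ginv_seq F n.+1) n); apply/funext => n.
rewrite /conv big_ord_recl subn0 /= nth_rcons size_ginv ltnn eqxx mulVKf //.
rewrite -[RHS]addr0 -addrA; congr (_ + _); apply/eqP; rewrite addrC subr_eq0; apply/eqP.
apply: eq_bigr => i _; congr (_ * _); rewrite [RHS]nth_ginv //; have := ltn_ord i; lia.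
Qed.

Lemma linvP f : f != 0 -> exists g, g * f = 1.
Proof.
move=> f0; have [a [F fE]] := shiftP f.
have /ex_minnP[n Fn minF] : exists n, F n != 0.
  apply: contrapT => /forallNP F0; move/eqP: f0; apply; apply: laurentP.
  rewrite fE; apply/funext => k; rewrite /shifted; case: ifP => // _.
  by have /negP := F0 `|k - a|%N; rewrite negbK => /eqP.
have {}fE : lcoef f = shifted (a + n%:Z) (fun i => F (n + i)%N).
  rewrite fE; apply/funext => k; rewrite /shifted.
  case: (leP a k) => ak; case: (leP (a + n%:Z) k) => ank; rewrite ?(le_gtF _)//; last by lia.
    by congr F; lia.
  by apply: contrapT => /eqP /minF; lia.
have [|G FG] := @conv_inv (fun i => F (n + i)%N); first by rewrite addn0.
exists (Laurent (shifted_bdd (- (a + n%:Z)) G)); apply: laurentP.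
by rewrite -[LHS]/(mulc (shifted _ G) (lcoef f)) fE mulc_shifted convC FG addNr -lone_shifted.
Qed.

Definition linv f : laurent K :=
  if pselect (exists g, g * f = 1) is left fP then projT1 (cid fP) else 0.

Lemma lmulVf f : f != 0 -> linv f * f = 1.
Proof.
by move=> /linvP fP; rewrite /linv; case: pselect => // fP'; case: cid.
Qed.

Lemma linv0 : linv 0 = 0.
Proof.
rewrite /linv; case: pselect => // fP; exfalso.
by case: fP => g; rewrite mulr0 => /esym /eqP; rewrite oner_eq0.
Qed.

HB.instance Definition _ := GRing.ComNzRing_isField.Build (laurent K) lmulVf linv0.

End LaurentField.

Section LaurentOps.
Variable K : fieldType.
Implicit Types (f : laurent K) (c : K).

Lemma lconst_bdd c : bounded_below (fun k => if k == 0 then c else 0).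
Proof. by exists 0 => k k0; rewrite lt_eqF. Qed.
Definition lconst c : laurent K := Laurent (lconst_bdd c).

Lemma lvar_bdd : bounded_below (fun k : int => (k == 1)%:R : K).
Proof. by exists 1 => k k1; rewrite lt_eqF. Qed.
Definition lvar : laurent K := Laurent lvar_bdd.

(* sum_(l >= 0) F l * z ^ (a + l) *)
Definition lseries (a : int) (F : nat -> K) : laurent K := Laurent (shifted_bdd a F).

(* Only ever applied to sequences bounded below; the other branch is junk. *)
Definition lofun (g : int -> K) : laurent K :=
  if pselect (bounded_below g) is left bg then Laurent bg else 0.

Lemma lderiv_bdd f : bounded_below (fun k => (k + 1)%:~R * lcoef f (k + 1)).
Proof.
have [a f0] := lcoef_bdd f; exists (a - 1) => k ka.
by rewrite f0 ?mulr0 // -ltrBrDr.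
Qed.
Definition lderiv f : laurent K := Laurent (lderiv_bdd f).

(* f(z ^ 2) *)
Lemma lsq_bdd f :
  bounded_below (fun k => if (2 %| k)%Z then lcoef f (k %/ 2)%Z else 0).
Proof.
have [a f0] := lcoef_bdd f; exists (2 * a) => k ka; case: ifP => // _.
by apply: f0; lia.
Qed.
Definition lsq f : laurent K := Laurent (lsq_bdd f).

(* f(- z) *)
Lemma lneg_bdd f : bounded_below (fun k => (-1) ^ k * lcoef f k).
Proof. by have [a f0] := lcoef_bdd f; exists a => k /f0 ->; rewrite mulr0. Qed.
Definition lneg f : laurent K := Laurent (lneg_bdd f).

Definition lres f : K := lcoef f (-1).

Definition power_series f := forall k : int, k < 0 -> lcoef f k = 0.

Definition peval (p : {poly K}) (X : laurent K) : laurent K := (map_poly lconst p).[X].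

(* FPrim g c stands for g + c * log z. *)
Record fprim := FPrim { fp_reg : laurent K; fp_log : K }.

Lemma fp_int_bdd f : bounded_below (fun k => if k == 0 then 0 else lcoef f (k - 1) / k%:~R).
Proof.
have [a f0] := lcoef_bdd f; exists a => k ka; case: ifP => // _.
by rewrite f0 ?mul0r //; lia.
Qed.

(* The formal primitive of f(z)dz without constant term. *)
Definition fp_int f : fprim := FPrim (Laurent (fp_int_bdd f)) (lres f).

Definition fp_deriv (u : fprim) : laurent K :=
  lderiv (fp_reg u) + lconst (fp_log u) / lvar.

End LaurentOps.

Section Matrices.

Definition mx2 (T : Type) (a b c d : T) : 'M[T]_2 :=
  \matrix_(i, j) (if i == 0 then (if j == 0 then a else b)
                  else (if j == 0 then c else d)).

Definition diag2 (A : nzRingType) (a d : A) : 'M[A]_2 := mx2 a 0 0 d.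

Variable K : fieldType.
Local Notation L := (laurent K).
Local Notation z := (lvar K).

Definition cmx (A : 'M[K]_2) : 'M[L]_2 := map_mx (@lconst K) A.

Definition dmx (A : 'M[L]_2) : 'M[L]_2 := map_mx (@lderiv K) A.

(* The matrix of the connection d + A dz in the frame M. *)
Definition gauge (M A : 'M[L]_2) : 'M[L]_2 :=
  invmx M *m dmx M + invmx M *m A *m M.

Definition series_mx (M : 'M[L]_2) := forall a b, power_series (M a b).

Definition GL2_series (M : 'M[L]_2) := series_mx M /\ lcoef (\det M) 0 != 0.

Definition ramified_block (alpha beta : L) : 'M[L]_2 :=
  mx2 alpha beta (z * beta) (alpha - (2%:R * z)^-1).

(* The matrix A(x)dx pulled back by x = zeta ^ 2. *)
Definition pullback (A : 'M[L]_2) : 'M[L]_2 :=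
  lderiv (z ^+ 2) *: map_mx (@lsq K) A.

Definition Mzeta : 'M[L]_2 := mx2 1 1 z (- z).

(* FSol Y (u, v) stands for Y * exp(- diag(u, v)).  *)
Record fsol := FSol { amp : 'M[L]_2; expo : fprim K * fprim K }.

Definition fsol_deriv (psi : fsol) : fsol :=
  FSol (dmx (amp psi)
        - amp psi *m diag2 (fp_deriv (expo psi).1) (fp_deriv (expo psi).2))
       (expo psi).

Definition horizontal (A : 'M[L]_2) (psi : fsol) :=
  amp (fsol_deriv psi) + A *m amp psi = 0.

End Matrices.

Definition Cx (R : realType) : numFieldType := R[i].

Inductive sing_kind := Regular | Unramified | Ramified.

Definition is_ramified (k : sing_kind) := if k is Ramified then true else false.

(* The indices 1, ..., nu, infinity: Some i is the (i+1)-st point, None is infinity. *)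
Definition sing (nu : nat) : finType := option 'I_nu.

(* thp, thm, thr are the given theta^+_{l,t_i}, theta^-_{l,t_i}, theta_{l',t_i};
   only the indices l < n_i, resp. l' <= 2 n_i - 2, are meaningful.  *)
Record setting (R : realType) (nu : nat) := Setting {
  tpos : 'I_nu -> Cx R;
  pord : sing nu -> nat;
  kind : sing nu -> sing_kind;
  thp : sing nu -> nat -> Cx R;
  thm : sing nu -> nat -> Cx R;
  thr : sing nu -> nat -> Cx R;
  _ : (2 <= nu)%N;
  _ : forall i : 'I_nu, i = 0%N :> nat -> tpos i = 0;
  _ : forall i : 'I_nu, i = 1%N :> nat -> tpos i = 1;
  _ : injective tpos;
  _ : forall i, kind i = Regular -> pord i = 1%N;
  _ : forall i, kind i <> Regular -> (1 < pord i)%N;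
  _ : exists i, kind i = Ramified;
  _ : forall i, kind i = Unramified -> thp i 0 <> thm i 0;
  _ : forall i, kind i = Ramified -> thr i 1 <> 0;
  _ : \sum_(i | ~~ is_ramified (kind i)) (thp i (pord i).-1 + thm i (pord i).-1)
      + \sum_(i | is_ramified (kind i)) (thr i (2 * pord i - 2)%N - 2%:R^-1) = -1;
  _ : forall i, kind i = Regular -> forall k : int, thp i 0 - thm i 0 <> k%:~R
}.

Section TwoForm.
Variables (R : realType) (nu : nat) (S : setting R nu).
Local Notation C := (Cx R).
Local Notation L := (laurent C).
Local Notation z := (lvar C).

Definition total_order : nat := \sum_(i : sing nu) pord S i.
Definition nq : nat := (total_order - 3)%N.

(* Ordered coordinates (q, p); the moduli space is the quotient of the open set
   below by the free action of the permutations of the pairs (q_j, p_j), so that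
   these are local coordinates on it. *)
Definition param : normedModType C := ('rV[C]_nq * 'rV[C]_nq)%type.

Definition qc (j : 'I_nq) (m : param) : C := m.1 0 j.
Definition pc (j : 'I_nq) (m : param) : C := m.2 0 j.

Definition moduli : set param :=
  [set m | (forall j k, qc j m = qc k m -> j = k) /\ (forall j i, qc j m <> tpos S i)].

Definition Ppoly : {poly C} := \prod_(i < nu) ('X - (tpos S i)%:P) ^+ pord S (Some i).

Record nform := NForm {
  nfC : 'I_nu -> {poly C};
  nfD : 'I_nu -> {poly C};
  nfCinf : {poly C};
  nfDinf : {poly C};
  nfCtilde : {poly C}
}.

Definition degree_bounds (F : nform) : Prop :=
  [/\ forall i, (size (nfC F i) <= pord S (Some i))%N,
      forall i, (size (nfD F i) <= pord S (Some i))%N,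
      (size (nfCinf F) <= pord S None)%N,
      (size (nfDinf F) <= (pord S None).-1)%N &
      (size (nfCtilde F) <= total_order - 3)%N].

(* Rational functions of x, evaluated at a Laurent series X. *)
Definition c0 (F : nform) (m : param) (X : L) : L :=
  \sum_(i < nu) peval (nfC F i) X / (X - lconst (tpos S i)) ^+ pord S (Some i)
  + \sum_(j < nq) lconst (pc j m) / (X - lconst (qc j m))
  + peval (nfCtilde F) X + X ^+ (total_order - 3) * peval (nfCinf F) X.

Definition d0 (F : nform) (m : param) (X : L) : L :=
  \sum_(i < nu) peval (nfD F i) X / (X - lconst (tpos S i)) ^+ pord S (Some i)
  - \sum_(j < nq) (X - lconst (qc j m))^-1
  + peval (nfDinf F) X.

Definition Omega (F : nform) (m : param) (X : L) : 'M[L]_2 :=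
  mx2 0 (peval Ppoly X)^-1 (c0 F m X) (d0 F m X).

(* Coefficient of dz of the connection matrix at t_i, expanded in the local coordinate
   z = x - t_i, resp. z = w = 1/x at infinity, where it is the matrix on U_infinity. *)
Definition Omega_at (F : nform) (m : param) (i : sing nu) : 'M[L]_2 :=
  match i with
  | Some a => Omega F m (lconst (tpos S a) + z)
  | None => gauge (diag2 1 (z^-1 ^+ (total_order - 2)))
                  (lderiv z^-1 *: Omega F m z^-1)
  end.

(* Expansion in z = x - q_j. *)
Definition Omega_q (F : nform) (m : param) (j : 'I_nq) : 'M[L]_2 :=
  Omega F m (lconst (qc j m) + z).

Definition apparent (F : nform) (m : param) (j : 'I_nq) : Prop :=
  series_mx (gauge (mx2 1 0 (lconst (pc j m)) z) (Omega_q F m j)).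

Definition unramified_data (A : 'M[L]_2) (n : nat) (a b : nat -> C) : Prop :=
  exists2 M : 'M[L]_2, GL2_series M &
    gauge M A = \sum_(l < n) z ^ (l%:Z - n%:Z) *: cmx (diag2 (a l) (b l)).

Definition ramified_data (A : 'M[L]_2) (n : nat) (a : nat -> C) : Prop :=
  exists2 M : 'M[L]_2, GL2_series M &
    gauge M A = ramified_block
      (\sum_(l < n) lconst (a (2 * l)%N / 2%:R) * z ^ (l%:Z - n%:Z))
      (\sum_(l < n.-1) lconst (a (2 * l + 1)%N / 2%:R) * z ^ (l%:Z - n%:Z)).

Definition local_data (A : 'M[L]_2) (i : sing nu) : Prop :=
  if is_ramified (kind S i) then ramified_data A (pord S i) (thr S i)
  else unramified_data A (pord S i) (thp S i) (thm S i).

Definition is_normal_form (m : param) (F : nform) : Prop :=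
  [/\ degree_bounds F, forall j, apparent F m j & forall i, local_data (Omega_at F m i) i].

(* Phi_i; the theta^+_{l,t_i}, theta^-_{l,t_i}, theta_{l',t_i} for all l, l' (functions on
   the moduli space); Xi_i; Xi_{q_j} as a series in x - q_j. *)
Record solutions := Solutions {
  Phi : sing nu -> 'M[C]_2;
  fthp : param -> sing nu -> nat -> C;
  fthm : param -> sing nu -> nat -> C;
  fthr : param -> sing nu -> nat -> C;
  Xi : param -> sing nu -> 'M[L]_2;
  Xiq : param -> 'I_nq -> 'M[L]_2
}.

Implicit Types (F : param -> nform) (Y : solutions).

Definition psi_unr Y (i : sing nu) (m : param) : fsol C :=
  FSol (cmx (Phi Y i) *m Xi Y m i)
       (fp_int (lseries (- (pord S i)%:Z) (fthp Y m i)),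
        fp_int (lseries (- (pord S i)%:Z) (fthm Y m i))).

(* In the variable z = zeta_i. *)
Definition psi_ram Y (i : sing nu) (m : param) : fsol C :=
  FSol (cmx (Phi Y i) *m map_mx (@lsq C) (Xi Y m i) *m Mzeta C)
       (fp_int (lseries (1 - (2 * pord S i)%:Z) (fthr Y m i)),
        fp_int (lseries (1 - (2 * pord S i)%:Z) (fun l => (-1) ^+ l * fthr Y m i l))).

Definition psi_q Y (j : 'I_nq) (m : param) : 'M[L]_2 :=
  mx2 1 0 (lconst (pc j m)) 1 *m Xiq Y m j *m diag2 1 z.

(* The coefficient of z ^ k of a matrix of Laurent series. *)
Definition coef_mx (A : 'M[L]_2) (k : int) : 'M[C]_2 := map_mx (fun f => lcoef f k) A.

Definition unramified_solution F Y (i : sing nu) : Prop :=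
  Phi Y i \in unitmx /\
  forall m, moduli m ->
  [/\ coef_mx (cmx (invmx (Phi Y i)) *m Omega_at (F m) m i *m cmx (Phi Y i))
              (- (pord S i)%:Z) = diag2 (thp S i 0) (thm S i 0),
      forall l, (l < pord S i)%N ->
        fthp Y m i l = thp S i l /\ fthm Y m i l = thm S i l,
      series_mx (Xi Y m i) /\ coef_mx (Xi Y m i) 0 = 1%:M,
      forall a, Xi Y m i a a = 1 &
      horizontal (Omega_at (F m) m i) (psi_unr Y i m)].

Definition ramified_solution F Y (i : sing nu) : Prop :=
  Phi Y i \in unitmx /\
  forall m, moduli m ->
  [/\ coef_mx (cmx (invmx (Phi Y i)) *m Omega_at (F m) m i *m cmx (Phi Y i))
              (- (pord S i)%:Z)
        = mx2 (thr S i 0 / 2%:R) (thr S i 1 / 2%:R) 0 (thr S i 0 / 2%:R),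
      forall l, (l <= 2 * pord S i - 2)%N -> fthr Y m i l = thr S i l,
      series_mx (Xi Y m i) /\ coef_mx (Xi Y m i) 0 = 1%:M,
      gauge (cmx (Phi Y i) *m Xi Y m i) (Omega_at (F m) m i) = ramified_block
        (lseries (- (pord S i)%:Z) (fun l => fthr Y m i (2 * l)%N / 2%:R))
        (lseries (- (pord S i)%:Z) (fun l => fthr Y m i (2 * l + 1)%N / 2%:R)) &
      exists2 xi : L, power_series xi &
        invmx (Mzeta C) *m map_mx (@lsq C) (Xi Y m i) *m Mzeta C
        = mx2 1 (z * xi) (- (z * lneg xi)) 1].

Definition convergent (f : L) : Prop :=
  power_series f /\
  exists2 r : C, r != 0 & cvgn (series (fun k : nat => lcoef f k%:Z * r ^+ k)).

(* Xi_{q_j} is not determined by its equation, hence the requirement that the choice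
   depend holomorphically on the parameters. *)
Definition apparent_solution F Y (j : 'I_nq) : Prop :=
  forall m, moduli m ->
  [/\ forall a b, convergent (Xiq Y m j a b),
      forall a b (k : int), differentiable (fun m' : param => lcoef (Xiq Y m' j a b) k) m,
      coef_mx (Xiq Y m j) 0 = 1%:M &
      dmx (psi_q Y j m) + Omega_q (F m) m j *m psi_q Y j m = 0].

Section Delta.
Variables (v m : param).

(* Derivative at m along v, the variable z being fixed. *)
Definition dparam (f : param -> L) : L :=
  lofun (fun k => 'D_v (fun m' => lcoef (f m') k) m).

Definition dparam_mx (A : param -> 'M[L]_2) : 'M[L]_2 :=
  \matrix_(a, b) dparam (fun m' => A m' a b).

(* Derivative with x fixed when A is expanded in z = x - c, the centre c moving with m. *)
Definition dparam_mx_at (c : param -> C) (A : param -> 'M[L]_2) : 'M[L]_2 :=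
  dparam_mx A - lconst ('D_v c m) *: dmx (A m).

Definition dparam_fp (u : param -> fprim C) : fprim C :=
  FPrim (dparam (fun m' => fp_reg (u m'))) ('D_v (fun m' => fp_log (u m')) m).

(* delta(psi) psi^{-1}.  The coefficients of log z in the exponents are the fixed constants
   theta^{+-}_{n_i - 1, t_i}, resp. theta_{2 n_i - 2, t_i}, so the logarithmic part of
   their derivatives vanishes and only the Laurent part contributes. *)
Definition dlog_fsol (psi : param -> fsol C) : 'M[L]_2 :=
  (dparam_mx (fun m' => amp (psi m'))
   - amp (psi m) *m diag2 (fp_reg (dparam_fp (fun m' => (expo (psi m')).1)))
                          (fp_reg (dparam_fp (fun m' => (expo (psi m')).2))))
  *m invmx (amp (psi m)).

Definition dlog_at (c : param -> C) (psi : param -> 'M[L]_2) : 'M[L]_2 :=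
  dparam_mx_at c psi *m invmx (psi m).

End Delta.

(* res Tr (delta(A) /\ delta(psi) psi^{-1}) evaluated on two vectors v1, v2, with A_k and
   B_k the values on v_k of delta(A) and delta(psi) psi^{-1}. *)
Definition res_tr_wedge (A1 A2 B1 B2 : 'M[L]_2) : C :=
  lres (\tr (A1 *m B2 - B1 *m A2)).

Definition omega F Y (m v1 v2 : param) : C :=
  2%:R^-1 * \sum_(i | ~~ is_ramified (kind S i))
    (let A := fun m' => Omega_at (F m') m' i in
     res_tr_wedge (dparam_mx v1 m A) (dparam_mx v2 m A)
       (dlog_fsol v1 m (psi_unr Y i)) (dlog_fsol v2 m (psi_unr Y i)))
  + 4%:R^-1 * \sum_(i | is_ramified (kind S i))
    (let A := fun m' => pullback (Omega_at (F m') m' i) in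
     res_tr_wedge (dparam_mx v1 m A) (dparam_mx v2 m A)
       (dlog_fsol v1 m (psi_ram Y i)) (dlog_fsol v2 m (psi_ram Y i)))
  + 2%:R^-1 * \sum_(j < nq)
    (let A := fun m' => Omega_q (F m') m' j in
     res_tr_wedge (dparam_mx_at v1 m (qc j) A) (dparam_mx_at v2 m (qc j) A)
       (dlog_at v1 m (qc j) (psi_q Y j)) (dlog_at v2 m (qc j) (psi_q Y j))).

(* (df /\ dg)(v1, v2) at m *)
Definition dwedge (f g : param -> C) (m v1 v2 : param) : C :=
  'D_v1 f m * 'D_v2 g m - 'D_v2 f m * 'D_v1 g m.

End TwoForm.

Arguments moduli {R nu} S _.

(* Main.v *)
Require Import Defs.
From mathcomp Require Import all_boot all_order all_algebra.
From mathcomp Require Import boolp classical_sets functions reals topology normedtype derive.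
From mathcomp Require Import zify ring.
From HB Require Import structures.
Set Implicit Arguments.
Unset Strict Implicit.
Unset Printing Implicit Defensive.
Import Order.TTheory GRing.Theory Num.Theory.
Import numFieldNormedType.Exports.
Local Open Scope classical_set_scope.
Local Open Scope ring_scope.

(* At each t_i the local data fix, through the trace and the trace of the square,
   the polar part of the connection matrix, so that its variation is holomorphic
   there.  The variation of psi_i is holomorphic too (with a pole compensated by the
   zero of the pull-back dx = 2 zeta dzeta in the ramified case), and the residues at
   the t_i vanish.  In particular the coefficients D_i and D_oo are constant.

   At q_j, write psi = Phi Y with Phi = [1, 0; p, x - q] and Y holomorphic and
   invertible.  The connection becomes holomorphic in the frame Phi and V =
   delta(Y) Y^{-1} is holomorphic; the horizontality of Y expresses the derivatives of
   the entries of V that enter the residue by V itself and by the variation of the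
   connection.  All terms in V cancel, and half the residue is
   (delta_1 p delta_2 q - delta_2 p delta_1 q) / P(q)
     - sum_(k <> j) (delta_1 q_j delta_2 q_k - delta_2 q_j delta_1 q_k) / (q_j - q_k)^2,
   where the last terms are antisymmetric in j and k. *)

(** * Laurent series *)

(** The normal form [F m] is given point by point: nothing is assumed about how its coefficients
    vary with [m]. At the t_i this is harmless. The coefficients of negative order are locally
    constant and have derivative zero, and the residue does not see the value of ['D_v] on the
    others. At q_j, the entry [d0] is explicit once the D_i and D_oo are known to be constant, while
    [c0] is recovered from the solution: the equation of Y expresses the lower-left entry of the
    connection in the frame Phi through Y, whose coefficients are differentiable by hypothesis.

    Two traces suffice for the polar part because the matrix is [0, b; c, d] with b known and having
    a pole of order at least n_i. The trace gives d up to a power series, tr A^2 = 2bc + d^2 gives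
    bc up to a pole of order n_i, and division by b gives c up to a power series.

    The factors 1/2 in omega are compensated at q_j, where each surviving term occurs twice in the
    residue. *)

Section Valuation.
Variable K : fieldType.
Local Notation L := (laurent K).
Local Notation z := (lvar K).
Implicit Types (f g X : L) (c : K).

Lemma laurent_ext f g : (forall k, lcoef f k = lcoef g k) -> f = g.
Proof. by move=> fg; apply: laurentP; apply/funext. Qed.

Lemma lcoef0 k : lcoef (0 : L) k = 0. Proof. by []. Qed.
Lemma lcoef1 k : lcoef (1 : L) k = (k == 0)%:R. Proof. by []. Qed.
Lemma lcoefD f g k : lcoef (f + g) k = lcoef f k + lcoef g k. Proof. by []. Qed.
Lemma lcoefN f k : lcoef (- f) k = - lcoef f k. Proof. by []. Qed.
Lemma lcoefB f g k : lcoef (f - g) k = lcoef f k - lcoef g k. Proof. by []. Qed.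

Lemma lcoef_sum I (r : seq I) (P : pred I) (F : I -> L) k :
  lcoef (\sum_(i <- r | P i) F i) k = \sum_(i <- r | P i) lcoef (F i) k.
Proof. by apply: (big_morph (fun f => lcoef f k)). Qed.

(** A lower bound for the order of [f], not the order itself, so that it is stable under sums and
    holds for 0. [vge 0] is convertible to [power_series]. *)
Definition vge (a : int) f := forall k, k < a -> lcoef f k = 0.

Lemma vgeW a b f : b <= a -> vge a f -> vge b f.
Proof. by move=> ba fa k kb; apply: fa; apply: lt_le_trans ba. Qed.

Lemma vgeD a f g : vge a f -> vge a g -> vge a (f + g).
Proof. by move=> fa ga k ka; rewrite lcoefD fa ?ga ?addr0. Qed.

Lemma vgeN a f : vge a f -> vge a (- f).
Proof. by move=> fa k ka; rewrite lcoefN fa ?oppr0. Qed.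

Lemma vgeB a f g : vge a f -> vge a g -> vge a (f - g).
Proof. by move=> fa ga; apply/vgeD/vgeN. Qed.

Lemma vge_sum a I (r : seq I) (P : pred I) (F : I -> L) :
  (forall i, P i -> vge a (F i)) -> vge a (\sum_(i <- r | P i) F i).
Proof. by move=> Fa; elim/big_ind: _ => //; apply: vgeD. Qed.

Lemma vge_shifted a f : vge a f -> lcoef f = shifted a (fun n => lcoef f (a + n%:Z)).
Proof. exact: bdd_shifted. Qed.

Lemma vge_ex f : exists a, vge a f.
Proof. by have [a fa] := lcoef_bdd f; exists a. Qed.

Lemma vge_lseries a F : vge a (lseries a F).
Proof. by move=> k ka; rewrite /= /shifted leNgt ka. Qed.

(** The product is defined by a finitely supported sum over [int]; lower bounds on both factors,
    sharp or not, turn it into a Cauchy sum whose range depends only on these bounds. A whole family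
    with common bounds thus has coefficients given by one finite formula. *)
Lemma lcoefM a b f g (n : nat) : vge a f -> vge b g ->
  lcoef (f * g) (a + b + n%:Z) =
  \sum_(i < n.+1) lcoef f (a + i%:Z) * lcoef g (b + (n - i)%N%:Z).
Proof.
move=> /vge_shifted fa /vge_shifted gb.
by rewrite -[lcoef (f * g)]/(Defs.mulc (lcoef f) (lcoef g)) fa gb mulc_shifted shiftedE -fa -gb.
Qed.

Lemma vgeM a b f g : vge a f -> vge b g -> vge (a + b) (f * g).
Proof.
move=> /vge_shifted fa /vge_shifted gb k kab.
by rewrite -[lcoef (f * g)]/(Defs.mulc (lcoef f) (lcoef g)) fa gb mulc_shifted /shifted leNgt kab.
Qed.

Lemma vge0M f g : vge 0 f -> vge 0 g -> vge 0 (f * g).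
Proof. exact: vgeM. Qed.

Lemma lcoefM0 f g : vge 0 f -> vge 0 g -> lcoef (f * g) 0 = lcoef f 0 * lcoef g 0.
Proof.
by move=> f0 g0; rewrite -[in LHS](addr0 0) -[X in _ + X]addr0 (lcoefM 0 f0 g0) big_ord1.
Qed.

Lemma vge1 : vge 0 (1 : L).
Proof. by move=> k k0; rewrite lcoef1 lt_eqF. Qed.

Lemma vge0X f n : vge 0 f -> vge 0 (f ^+ n).
Proof. by move=> f0; elim: n => [|n IH]; [exact: vge1 | rewrite exprS; apply: vge0M]. Qed.

Lemma vgeX a f n : vge a f -> vge (a * n%:Z) (f ^+ n).
Proof.
move=> fa; elim: n => [|n IH]; first by rewrite mulr0 expr0; apply: vge1.
by rewrite exprS intS mulrDr mulr1; apply: vgeM.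
Qed.

Lemma lconst_is_zmod_morphism : zmod_morphism (@lconst K).
Proof. by move=> x y; apply: laurent_ext => k /=; case: ifP; rewrite ?subr0. Qed.

Lemma vge_lconst c : vge 0 (lconst c).
Proof. by move=> k k0 /=; rewrite lt_eqF. Qed.

Lemma lcoef_lconst0 c : lcoef (lconst c) 0 = c. Proof. by []. Qed.

Lemma lcoef_lconstM c f k : lcoef (lconst c * f) k = c * lcoef f k.
Proof.
have [a fa] := vge_ex f; case: (ltP k a) => ka.
  by rewrite (vgeM (vge_lconst c) fa) ?add0r // fa // mulr0.
have -> : k = 0 + a + (absz (k - a)%R)%:Z by lia.
rewrite (lcoefM _ (vge_lconst c) fa) big_ord_recl big1 => [|i _]; last first.
  by rewrite /= mul0r.
by rewrite !addr0 lcoef_lconst0 subn0 !add0r.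
Qed.

Lemma lconst_is_monoid_morphism : monoid_morphism (@lconst K).
Proof.
split=> [|x y]; apply: laurent_ext => k; first by rewrite /=; case: eqP.
by rewrite lcoef_lconstM /=; case: ifP; rewrite ?mulr0.
Qed.

HB.instance Definition _ := GRing.isZmodMorphism.Build K L (@lconst K) lconst_is_zmod_morphism.
HB.instance Definition _ := GRing.isMonoidMorphism.Build K L (@lconst K) lconst_is_monoid_morphism.

Lemma vge_z : vge 1 z.
Proof. by move=> k k1 /=; rewrite lt_eqF. Qed.

Lemma vge0_z : vge 0 z.
Proof. exact: vgeW vge_z. Qed.

Lemma lcoef_zM f k : lcoef (z * f) k = lcoef f (k - 1).
Proof.
have [a fa] := vge_ex f; case: (ltP (k - 1) a) => ka.
  by rewrite (vgeM vge_z fa) ?fa //; lia.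
have -> : k = 1 + a + (absz (k - 1 - a)%R)%:Z by lia.
rewrite (lcoefM _ vge_z fa) big_ord_recl big1 => [|i _]; last first.
  by rewrite /= mul0r.
by rewrite !addr0 mul1r subn0; congr lcoef; lia.
Qed.

Lemma z_neq0 : z != 0.
Proof. by apply/eqP => /(congr1 (fun f => lcoef f 1)) /= /eqP; rewrite oner_eq0. Qed.

Lemma lcoef_VzM f k : lcoef (z^-1 * f) k = lcoef f (k + 1).
Proof. by rewrite -[in RHS](mulVKf z_neq0 f) lcoef_zM addrK. Qed.

Lemma vge_Vz : vge (-1) z^-1.
Proof. by move=> k k1; rewrite -[z^-1]mulr1 lcoef_VzM lcoef1 lt_eqF //; lia. Qed.

Lemma vge_zexp (k : int) : vge k (z ^ k).
Proof.
case: k => n; first by have := @vgeX _ _ n vge_z; rewrite mul1r.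
by have := @vgeX _ _ n.+1 vge_Vz; rewrite NegzE mulN1r exprVn exprnN.
Qed.

Lemma vge_inv f : vge 0 f -> lcoef f 0 != 0 -> vge 0 f^-1.
Proof.
move=> /[dup] /vge_shifted fa f0 fn0.
have [|G FG] := @conv_inv _ (fun n : nat => lcoef f (0 + n%:Z)); first by rewrite addr0.
suff -> : f^-1 = lseries 0 G by apply: vge_lseries.
have fg1 : f * lseries 0 G = 1.
  apply: laurentP; rewrite -[lcoef (f * _)]/(Defs.mulc (lcoef f) (shifted 0 G)) fa mulc_shifted FG.
  by rewrite -lone_shifted.
have fn : f != 0 by apply: contraNneq fn0 => ->; rewrite lcoef0.
by apply: (mulfI fn); rewrite fg1 mulfV.
Qed.

Lemma neq0_lcoef0 f : lcoef f 0 != 0 -> f != 0.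
Proof. by apply: contraNneq => ->. Qed.

Lemma lcoef_inv0 f : vge 0 f -> lcoef f 0 != 0 -> lcoef f^-1 0 = (lcoef f 0)^-1.
Proof.
move=> f0 fn0; apply: (mulfI fn0); rewrite -lcoefM0 ?divff ?mulfV //; first exact: neq0_lcoef0.
exact: vge_inv.
Qed.

Lemma vge1_divz f : vge 0 f -> lcoef f 0 = 0 -> vge 0 (z^-1 * f).
Proof.
move=> f0 f00 k k0; rewrite lcoef_VzM; case: (ltP (k + 1) 0) => k1; first exact: f0.
by have -> : k + 1 = 0 by lia.
Qed.

Lemma lresD f g : lres (f + g) = lres f + lres g. Proof. by []. Qed.
Lemma lres_vge0 f : vge 0 f -> lres f = 0. Proof. by apply. Qed.
Lemma vge_deriv a f : vge a f -> vge (a - 1) (lderiv f).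
Proof. by move=> fa k ka /=; rewrite fa ?mulr0 //; lia. Qed.

(** The factor [k + 1] vanishes at [k = -1], so that no order is lost, in contrast with
    [vge_deriv]. *)
Lemma vge0_deriv f : vge 0 f -> vge 0 (lderiv f).
Proof.
move=> f0 k k0 /=; case: (ltP (k + 1) 0) => k1; first by rewrite f0 ?mulr0.
have -> : k + 1 = 0 by lia.
by rewrite mul0r.
Qed.

Lemma lcoef_deriv f k : lcoef (lderiv f) k = (k + 1)%:~R * lcoef f (k + 1).
Proof. by []. Qed.

Lemma lderivD f g : lderiv (f + g) = lderiv f + lderiv g.
Proof. by apply: laurent_ext => k; rewrite lcoefD /= mulrDr. Qed.

Lemma lderivN f : lderiv (- f) = - lderiv f.
Proof. by apply: laurent_ext => k; rewrite lcoefN /= mulrN. Qed.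

Lemma lderivB f g : lderiv (f - g) = lderiv f - lderiv g.
Proof. by rewrite lderivD lderivN. Qed.

Lemma lderiv_const c : lderiv (lconst c) = 0.
Proof.
apply: laurent_ext => k; rewrite lcoef0 /=.
by case: eqP => [->|_]; rewrite ?mul0r ?mulr0.
Qed.

Lemma lderiv_z : lderiv z = 1.
Proof.
apply: laurent_ext => k; rewrite lcoef1 /=.
have -> : (k + 1 == 1) = (k == 0) by lia.
by case: eqP => [->|_]; rewrite ?mulr0 // add0r mulr1.
Qed.

Lemma lderivM f g : lderiv (f * g) = lderiv f * g + f * lderiv g.
Proof.
have [[a fa] [b gb]] := (vge_ex f, vge_ex g); have := (vge_deriv fa, vge_deriv gb) => -[dfa dgb].
apply: laurent_ext => k; rewrite lcoefD.
case: (ltP k (a + b - 1)) => kab.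
  rewrite (vge_deriv (vgeM fa gb)) // (vgeM dfa gb) ?(vgeM fa dgb) ?addr0 //; lia.
have -> : k = a - 1 + b + (absz (k - (a + b - 1))%R)%:Z by lia.
set n := absz _; rewrite (lcoefM _ dfa gb).
have -> : a - 1 + b + n%:Z = a + (b - 1) + n%:Z by lia.
rewrite (lcoefM _ fa dgb) lcoef_deriv.
have -> : a + (b - 1) + n%:Z + 1 = a + b + n%:Z by lia.
rewrite (lcoefM _ fa gb) mulr_sumr -big_split; apply: eq_bigr => i _; rewrite !lcoef_deriv.
have ni := ltn_ord i.
have -> : a - 1 + i%:Z + 1 = a + i%:Z by lia.
have -> : b - 1 + (n - i)%N%:Z + 1 = b + (n - i)%N%:Z by lia.
have -> : a + b + n%:Z = (a + i%:Z) + (b + (n - i)%N%:Z) by lia.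
by rewrite rmorphD /=; ring.
Qed.

Lemma lderivV f : f != 0 -> lderiv f^-1 = - f^-1 * lderiv f * f^-1.
Proof.
move=> f0; apply: (mulfI f0); apply: (addrI (lderiv f * f^-1)).
rewrite -lderivM mulfV // -(rmorph1 (@lconst K)) lderiv_const.
by rewrite !mulNr !mulrN !mulrA mulfV // mul1r subrr.
Qed.

Lemma lderiv_Vz : lderiv z^-1 = - (z ^+ 2)^-1.
Proof. by rewrite lderivV ?z_neq0 // lderiv_z mulr1 mulNr expr2 invfM. Qed.

Lemma lcoef_zX n k : lcoef (z ^+ n) k = (k == n%:Z)%:R.
Proof.
elim: n k => [|n IH] k; first by rewrite expr0 lcoef1.
by rewrite exprS lcoef_zM IH; congr (_%:R); congr nat_of_bool; lia.
Qed.

Lemma lcoef_VzX n k : lcoef (z^-1 ^+ n) k = (k == - n%:Z)%:R.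
Proof.
elim: n k => [|n IH] k; first by rewrite expr0 lcoef1.
by rewrite exprS lcoef_VzM IH; congr (_%:R); congr nat_of_bool; lia.
Qed.

Lemma lcoef_peval (p : {poly K}) k :
  lcoef (peval p z) k = if 0 <= k then p`_`|k|%N else 0.
Proof.
rewrite /peval horner_coef size_map_poly lcoef_sum.
under eq_bigr => i _ do rewrite coef_map lcoef_lconstM lcoef_zX.
case: leP => k0; last first.
  by rewrite big1 // => i _; rewrite lt_eqF ?mulr0 //; lia.
case: (ltnP `|k| (size p)) => kp.
  rewrite (bigD1 (Ordinal kp)) //= big1 ?addr0 => [|i /eqP ik].
    by rewrite gez0_abs // eqxx mulr1.
  by case: eqP => [ki|_]; rewrite ?mulr0 //; case: ik; apply: val_inj => /=; lia.
rewrite nth_default // big1 // => i _.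
by case: eqP => [ki|_]; rewrite ?mulr0 //; have := ltn_ord i; lia.
Qed.

Lemma pevalE (p : {poly K}) X : peval p X = (map_poly (@lconst K) p).[X]. Proof. by []. Qed.

Lemma pevalB (p q : {poly K}) X : peval (p - q) X = peval p X - peval q X.
Proof. by rewrite !pevalE rmorphB !hornerE. Qed.
Lemma pevalC c X : peval c%:P X = lconst c.
Proof. by rewrite pevalE map_polyC hornerC. Qed.
Lemma pevalX X : peval 'X X = X.
Proof. by rewrite pevalE map_polyX hornerX. Qed.
Lemma pevalM (p q : {poly K}) X : peval (p * q) X = peval p X * peval q X.
Proof. by rewrite !pevalE rmorphM !hornerE. Qed.
Lemma pevalXn (p : {poly K}) n X : peval (p ^+ n) X = peval p X ^+ n.
Proof. by rewrite !pevalE rmorphXn !hornerE. Qed.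
Lemma peval_prod I (r : seq I) (P : pred I) (F : I -> {poly K}) X :
  peval (\prod_(i <- r | P i) F i) X = \prod_(i <- r | P i) peval (F i) X.
Proof.
by apply: (big_morph (fun p => peval p X)) => [p q|]; [exact: pevalM | rewrite pevalC rmorph1].
Qed.

Lemma peval_shift (p : {poly K}) c :
  peval p (lconst c + z) = peval (p \Po ('X + c%:P)) z.
Proof.
rewrite !pevalE map_comp_poly horner_comp rmorphD /= map_polyX map_polyC !hornerE.
by rewrite addrC.
Qed.

Lemma vge0_peval (p : {poly K}) X : vge 0 X -> vge 0 (peval p X).
Proof.
move=> X0; rewrite /peval horner_coef; apply: vge_sum => i _; rewrite coef_map.
by apply/vge0M/vge0X => //; apply: vge_lconst.
Qed.

Lemma lcoef0_peval (p : {poly K}) c : lcoef (peval p (lconst c + z)) 0 = p.[c].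
Proof.
by rewrite peval_shift lcoef_peval lexx /= -horner_coef0 horner_comp !hornerE.
Qed.

(** Recovers the numerators over [(x - t_i) ^+ n_i] from polar parts: a zero of order [n] kills
    every Taylor coefficient at [c] that the degree allows, and translation is invertible. *)
Lemma peval_shift_eq0 (p : {poly K}) c n :
  (size p <= n)%N -> vge n%:Z (peval p (lconst c + z)) -> p = 0.
Proof.
move=> pn; rewrite peval_shift => van.
suff p0 : p \Po ('X + c%:P) = 0.
  have : (p \Po ('X + c%:P)) \Po ('X - c%:P) = 0 by rewrite p0 comp_poly0.
  by rewrite -comp_polyA comp_polyD comp_polyX comp_polyC subrK comp_polyXr.
apply/polyP => i; rewrite coef0; case: (ltnP i n) => ni.
  by have := van i%:Z; rewrite lcoef_peval /=; apply; lia.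
rewrite nth_default // (leq_trans _ ni) // (leq_trans _ pn) //.
by rewrite size_comp_poly2 // size_XaddC.
Qed.

(** The coefficient of index [i] sits at order [-i]; the bound 1 rather than 0 also kills the
    constant term. *)
Lemma peval_inv_eq0 (p : {poly K}) : vge 1 (peval p z^-1) -> p = 0.
Proof.
move=> v1; apply/polyP => i; rewrite coef0; case: (ltnP i (size p)) => ip; last first.
  by rewrite nth_default.
have := v1 (- i%:Z); rewrite /peval horner_coef size_map_poly lcoef_sum.
under eq_bigr => j _.
  rewrite coef_map lcoef_lconstM lcoef_VzX.
  have -> : (- i%:Z == - (j : nat)%:Z) = (j == Ordinal ip) by rewrite -val_eqE /=; lia.
  over.
rewrite (bigD1 (Ordinal ip)) //= eqxx mulr1 big1 ?addr0; last first.
  by move=> j /negPf ->; rewrite mulr0.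
by apply; lia.
Qed.

End Valuation.

(** * Matrices of Laurent series and their normal forms *)

Section LaurentMatrices.
Variable K : fieldType.
Local Notation L := (laurent K).
Local Notation z := (lvar K).
Implicit Types (A B M T : 'M[L]_2).

Lemma mulmx2E (T : pzRingType) (A B : 'M[T]_2) i j :
  (A *m B) i j = A i 0 * B 0 j + A i 1 * B 1 j.
Proof. by rewrite mxE big_ord_recl big_ord1; congr (_ + A i _ * B _ j); apply: val_inj. Qed.

Lemma mxtrace2E (T : pzRingType) (A : 'M[T]_2) : \tr A = A 0 0 + A 1 1.
Proof. by rewrite /mxtrace big_ord_recl big_ord1; congr (_ + A _ _); apply: val_inj. Qed.

Lemma det2E (T : comPzRingType) (A : 'M[T]_2) :
  \det A = A 0 0 * A 1 1 - A 0 1 * A 1 0.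
Proof.
rewrite (expand_det_row _ 0) big_ord_recl big_ord1 /cofactor !det_mx11 !mxE /=.
rewrite expr0 expr1 mul1r mulN1r mulrN.
by congr (A _ _ * A _ _ - A _ _ * A _ _); apply: val_inj.
Qed.

Lemma invmx_eq (T : comUnitRingType) n (A B : 'M[T]_n) : A *m B = 1%:M -> invmx A = B.
Proof. by move=> AB; have [Au _] := mulmx1_unit AB; rewrite -[B](mulKmx Au) AB mulmx1. Qed.

Lemma invmxM (T : comUnitRingType) n (A B : 'M[T]_n) :
  A \in unitmx -> B \in unitmx -> invmx (A *m B) = invmx B *m invmx A.
Proof. by move=> Au Bu; apply: invmx_eq; rewrite mulmxA mulmxK // mulmxV. Qed.

Lemma mxtrace_sqrB (T : comPzRingType) n (Q E : 'M[T]_n) :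
  \tr ((Q - E) *m (Q - E)) =
  \tr (Q *m Q) - (\tr (Q *m E) + \tr (E *m Q) - \tr (E *m E)).
Proof.
by rewrite mulmxBl !mulmxBr !raddfB /=; ring.
Qed.

Lemma eq_mx2 (T : Type) (A B : 'M[T]_2) :
  A 0 0 = B 0 0 -> A 0 1 = B 0 1 -> A 1 0 = B 1 0 -> A 1 1 = B 1 1 -> A = B.
Proof.
move=> e00 e01 e10 e11; apply/matrixP => i j.
have ord2 (k : 'I_2) : k = 0 \/ k = 1.
  by case: k => [[|[|k]] ltk] //; [left | right]; apply: val_inj.
by case: (ord2 i) => ->; case: (ord2 j) => ->.
Qed.

Lemma mx2E (T : Type) (a b c d : T) :
  ((mx2 a b c d 0 0 = a) * (mx2 a b c d 0 1 = b)) *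
  ((mx2 a b c d 1 0 = c) * (mx2 a b c d 1 1 = d)).
Proof. by rewrite !mxE. Qed.

Definition mx_vge a M := forall i j, vge a (M i j).

Lemma mx_vge2 a (e f g h : L) :
  vge a e -> vge a f -> vge a g -> vge a h -> mx_vge a (mx2 e f g h).
Proof. by move=> ea fa ga ha i j; rewrite mxE; case: ifP; case: ifP. Qed.

Lemma mx_vgeD a A B : mx_vge a A -> mx_vge a B -> mx_vge a (A + B).
Proof. by move=> Aa Ba i j; rewrite mxE; apply: vgeD. Qed.

Lemma mx_vgeN a A : mx_vge a A -> mx_vge a (- A).
Proof. by move=> Aa i j; rewrite mxE; apply: vgeN. Qed.

Lemma mx_vgeB a A B : mx_vge a A -> mx_vge a B -> mx_vge a (A - B).
Proof. by move=> Aa Ba; apply/mx_vgeD/mx_vgeN. Qed.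

Lemma mx_vgeM a b A B : mx_vge a A -> mx_vge b B -> mx_vge (a + b) (A *m B).
Proof. by move=> Aa Bb i j; rewrite mulmx2E; apply: vgeD; apply: vgeM. Qed.

Lemma mx_vge0M A B : mx_vge 0 A -> mx_vge 0 B -> mx_vge 0 (A *m B).
Proof. exact: mx_vgeM. Qed.

Lemma mx_vgeW a b M : b <= a -> mx_vge a M -> mx_vge b M.
Proof. by move=> ba Ma i j; apply: vgeW ba _. Qed.

Lemma mx_vgeZ a b (f : L) M : vge a f -> mx_vge b M -> mx_vge (a + b) (f *: M).
Proof. by move=> fa Mb i j; rewrite mxE; apply: vgeM. Qed.

Lemma mx_vge_sum a I (r : seq I) (P : pred I) (F : I -> 'M[L]_2) :
  (forall i, P i -> mx_vge a (F i)) -> mx_vge a (\sum_(i <- r | P i) F i).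
Proof. by move=> Fa i j; rewrite summxE; apply: vge_sum => k /Fa. Qed.

Lemma vge_mxtrace a M : mx_vge a M -> vge a (\tr M).
Proof. by move=> Ma; rewrite mxtrace2E; apply: vgeD. Qed.

Lemma vge_det M : mx_vge 0 M -> vge 0 (\det M).
Proof. by move=> M0; rewrite det2E; apply: vgeB; apply: vge0M. Qed.

Lemma mx_vge_dmx M : mx_vge 0 M -> mx_vge 0 (dmx M).
Proof. by move=> M0 i j; rewrite mxE; apply: vge0_deriv. Qed.

Lemma mx_vge_cmx (A : 'M[K]_2) : mx_vge 0 (cmx A).
Proof. by move=> i j; rewrite mxE; apply: vge_lconst. Qed.

Lemma det_cmx (A : 'M[K]_2) : \det (cmx A) = lconst (\det A).
Proof. by rewrite /cmx det_map_mx. Qed.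

Lemma GL2_series_unit M : GL2_series M -> M \in unitmx.
Proof. by case=> _ d0; rewrite unitmxE unitfE; apply: neq0_lcoef0. Qed.

Lemma GL2_series_inv M : GL2_series M -> mx_vge 0 (invmx M).
Proof.
move=> /[dup] /GL2_series_unit Mu [M0 d0] i j; rewrite /invmx Mu mxE.
apply: vge0M; first by apply: vge_inv d0; apply: vge_det.
rewrite mxE /cofactor det_mx11 !mxE; apply: vge0M; last exact: M0.
by apply/vge0X/vgeN/vge1.
Qed.

Lemma GL2_series_cmx (A : 'M[K]_2) : A \in unitmx -> GL2_series (cmx A).
Proof.
move=> Au; split; first exact: mx_vge_cmx.
by rewrite det_cmx lcoef_lconst0 -unitfE -unitmxE.
Qed.

Lemma GL2_seriesM A B : GL2_series A -> GL2_series B -> GL2_series (A *m B).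
Proof.
move=> [A0 dA] [B0 dB]; split; first exact: mx_vge0M.
by rewrite det_mulmx lcoefM0 ?mulf_neq0 //; apply: vge_det.
Qed.

Lemma gauge_invE M A T : M \in unitmx -> gauge M A = T ->
  A = M *m T *m invmx M - dmx M *m invmx M.
Proof.
move=> Mu <-; rewrite /gauge mulmxDr mulmxDl !mulmxA mulmxV // !mul1mx.
by rewrite -!mulmxA mulmxV // mulmx1 addrAC subrr add0r.
Qed.

Lemma dmxM A B : dmx (A *m B) = dmx A *m B + A *m dmx B.
Proof.
apply/matrixP => i j; rewrite mxE mulmx2E mxE !mulmx2E !mxE lderivD !lderivM.
by rewrite addrACA.
Qed.

Lemma dmx1 : dmx (1%:M : 'M[L]_2) = 0.
Proof.
have c1 : (1%:M : 'M[L]_2) = cmx 1%:M by rewrite /cmx map_mx1.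
by apply/matrixP => i j; rewrite c1 !mxE lderiv_const.
Qed.

Lemma dmx_inv M : M \in unitmx -> dmx (invmx M) = - (invmx M *m dmx M *m invmx M).
Proof.
move=> Mu; have := dmxM (invmx M) M; rewrite mulVmx // dmx1 => /esym /(canRL (addrK _)).
by rewrite sub0r => /(congr1 (mulmxr (invmx M))); rewrite /= mulmxK // mulNmx.
Qed.

Lemma gauge_horizontal M A B : M \in unitmx ->
  dmx (M *m B) + A *m (M *m B) = 0 -> dmx B = - (gauge M A *m B).
Proof.
move=> Mu; rewrite dmxM => /(congr1 (mulmx (invmx M))); rewrite mulmx0 !mulmxDr mulKmx //.
rewrite addrAC addrC => /(canRL (addrK _)); rewrite sub0r => ->.
by rewrite /gauge mulmxDl !mulmxA.
Qed.

(** Linearizing B' = -AB yields V' = [V, A] - dA for V = dB B^{-1}. Here [dB] is any solution of the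
    linearized equation, which keeps the statement free of parameters. *)
Lemma dmx_variation A dA B dB : B \in unitmx ->
  dmx B = - (A *m B) -> dmx dB = - (dA *m B + A *m dB) ->
  dmx (dB *m invmx B) = dB *m invmx B *m A - A *m (dB *m invmx B) - dA.
Proof.
move=> Bu ode dode; rewrite dmxM dode dmx_inv // ode !(mulmxN, mulNmx) opprK mulmxDl !mulmxA.
rewrite (mulmxK Bu dA) -[dB *m invmx B *m A *m B *m _]mulmxA mulmxV // mulmx1.
by rewrite opprD addrC addrA addrAC.
Qed.

Lemma mul_variation (B dB M dM : 'M[L]_2) : B \in unitmx -> M \in unitmx ->
  (dM *m B + M *m dB) *m invmx (M *m B) = (dM + M *m (dB *m invmx B)) *m invmx M.
Proof.
move=> Bu Mu.
have -> : dM + M *m (dB *m invmx B) = (dM *m B + M *m dB) *m invmx B.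
  by rewrite mulmxDl mulmxK // mulmxA.
by rewrite invmxM // mulmxA.
Qed.

(** Conjugation preserves both traces, and the remaining term [dmx M *m invmx M] is holomorphic: it
    changes the trace by a power series, and in the square its products with the conjugate of [T]
    have a pole of order at most [n]. *)
Lemma gauge_trace M A T (n : nat) : GL2_series M -> mx_vge (- n%:Z) T -> gauge M A = T ->
  vge 0 (\tr A - \tr T) /\ vge (- n%:Z) (\tr (A *m A) - \tr (T *m T)).
Proof.
move=> MG Tn MA; have Mu := GL2_series_unit MG; have N0 := GL2_series_inv MG.
have [M0 _] := MG; have D0 := mx_vge_dmx M0.
have -> := gauge_invE Mu MA; set N := invmx M in N0 *; set D := dmx M in D0 *.
have NM : N *m M = 1%:M by rewrite mulVmx.
have e1 : \tr (M *m T *m N) = \tr T by rewrite mxtrace_mulC mulmxA NM mul1mx.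
have e2 : \tr (M *m T *m N *m (M *m T *m N)) = \tr (T *m T).
  by rewrite !mulmxA -[M *m T *m N *m M]mulmxA NM mulmx1 mxtrace_mulC !mulmxA NM mul1mx.
split.
  rewrite raddfB /= e1 addrAC subrr add0r; apply/vgeN/vge_mxtrace.
  exact: mx_vge0M.
rewrite mxtrace_sqrB e2 addrAC subrr add0r.
have n0 : - n%:Z <= 0 by lia.
have MTN : mx_vge (- n%:Z) (M *m T *m N).
  by rewrite -[- _]addr0; apply: mx_vgeM N0; rewrite -[- _]add0r; apply: mx_vgeM.
have DN : mx_vge 0 (D *m N) by apply: mx_vge0M.
apply: vgeN; apply: vgeB; [apply: vgeD |]; apply: vge_mxtrace.
- by rewrite -[- _]addr0; apply: mx_vgeM.
- by rewrite -[- _]add0r; apply: mx_vgeM.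
- by apply: (mx_vgeW n0); apply: mx_vge0M.
Qed.

(** The identity tr A^2 = 2bc + d^2 for A = [0, b; c, d], subtracted for two matrices with the same
    b and solved for c' - c. The common reference value [s] will be the trace of the square of the
    normal form. *)
Lemma offdiag_eq (F : fieldType) (b c c' d d' s : F) : 2%:R != 0 :> F ->
  b * (c' - c) = 2%:R^-1 * ((b * c' + (c' * b + d' * d') - s)
                           - (b * c + (c * b + d * d) - s) - (d' - d) * (d + d')).
Proof. by move=> nz2; field. Qed.

(* The polar part of [tr A] up to order 1 and that of [tr (A *m A)] up to order
   [n + 1] only depend on the normal form of [A]. *)
Lemma polar_parts_eq M M' A A' T (n : nat) :
    (2%:R : K) != 0 -> GL2_series M -> GL2_series M' -> mx_vge (- n%:Z) T ->
    gauge M A = T -> gauge M' A' = T ->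
    A 0 0 = 0 -> A' 0 0 = 0 -> A 0 1 = A' 0 1 -> A 0 1 != 0 -> vge n%:Z (A 0 1)^-1 ->
  mx_vge 0 (A' - A).
Proof.
move=> nz2 MG MG' Tn MA MA' A00 A00' A01 b0 bn.
have [t1 s1] := gauge_trace MG Tn MA; have [t2 s2] := gauge_trace MG' Tn MA'.
have Ttr := vge_mxtrace Tn; have n0 : - n%:Z <= 0 by lia.
rewrite !mxtrace2E !mulmx2E -/(_ *m _) A00 A00' -A01 !mul0r !add0r in t1 s1 t2 s2.
rewrite mxtrace2E in Ttr.
set b := A 0 1 in b0 bn s1 s2; set tT := T 0 0 + T 1 1 in Ttr t1 t2.
set sT := T 0 0 * _ + _ + _ in s1 s2.
have dn : vge (- n%:Z) (A 1 1).
  by rewrite -[A 1 1](subrK tT); apply: vgeD => //; apply: vgeW t1.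
have dn' : vge (- n%:Z) (A' 1 1).
  by rewrite -[A' 1 1](subrK tT); apply: vgeD => //; apply: vgeW t2.
have e0 : vge 0 (A' 1 1 - A 1 1).
  rewrite [X in vge _ X](_ : _ = A' 1 1 - tT - (A 1 1 - tT)); first exact: vgeB.
  by rewrite opprB addrA subrK.
have c0 : vge 0 (A' 1 0 - A 1 0).
  (* As d' - d is already a power series, d'^2 - d^2 = (d' - d)(d + d') has a pole of order at most
     n only, like the differences of traces. Multiplying by [b^-1], which has a zero of order at
     least n, removes it. *)
  have bc : vge (- n%:Z) (b * (A' 1 0 - A 1 0)).
    have -> : b * (A' 1 0 - A 1 0) = lconst 2%:R^-1 *
        ((b * A' 1 0 + (A' 1 0 * b + A' 1 1 * A' 1 1) - sT)
         - (b * A 1 0 + (A 1 0 * b + A 1 1 * A 1 1) - sT)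
         - (A' 1 1 - A 1 1) * (A 1 1 + A' 1 1)).
      have -> : lconst 2%:R^-1 = (2%:R : L)^-1 by rewrite fmorphV rmorph_nat.
      have nz2L : (2%:R : L) != 0 by rewrite -(rmorph_nat (@lconst K)) fmorph_eq0.
      exact: offdiag_eq.
    rewrite -[X in vge X](add0r (- n%:Z)); apply: vgeM; first exact: vge_lconst.
    apply: vgeB; first exact: vgeB s2 s1.
    by rewrite -[X in vge X](add0r (- n%:Z)); apply: vgeM => //; apply: vgeD.
  by rewrite -(mulKf b0 (A' 1 0 - A 1 0)) -(subrr n%:Z); apply: vgeM.
rewrite (@eq_mx2 _ (A' - A) (mx2 0 0 (A' 1 0 - A 1 0) (A' 1 1 - A 1 1))).
- exact: mx_vge2.
- by rewrite !mxE A00 A00' subrr.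
- by rewrite !mxE -A01 subrr.
- by rewrite mx2E !mxE.
- by rewrite mx2E !mxE.
Qed.

End LaurentMatrices.

(** * Families of Laurent series *)

Lemma lofunE (K : fieldType) (g : int -> K) : bounded_below g -> lcoef (lofun g) = g.
Proof. by move=> gb; rewrite /lofun; case: pselect. Qed.

Section Families.
Variables (R : realType) (nu : nat) (S : setting R nu).
Local Notation C := (Cx R).
Local Notation L := (laurent C).
Local Notation z := (lvar C).
Variables (v m : param S).
Implicit Types (f g h : param S -> L) (df dg : L) (c : param S -> C).

(** The coefficients below [a] are locally constant, so their derivatives vanish; for the others any
    value of ['D_v] is acceptable, even where the derivative does not exist. The default value 0 of
    [lofun] satisfies the bound as well. *)
Lemma dparam_vge a f : (\forall m' \near m, vge a (f m' - f m)) -> vge a (dparam v m f).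
Proof.
move=> fa; rewrite /dparam /lofun; case: pselect => // gb k ka /=.
rewrite (@near_eq_derive _ _ _ _ (cst (lcoef (f m) k))) ?derive_cst //.
near=> m'; have fm' : vge a (f m' - f m) by near: m'.
by apply: subr0_eq; rewrite -lcoefB fm'.
Unshelve. all: by end_near. Qed.

(** The lower bound is uniform near [m]: this is what makes a coefficient of a product, near [m],
    one fixed finite sum that can be differentiated termwise. *)
Definition is_dparam f df :=
  (exists a, \forall m' \near m, vge a (f m')) /\
  forall k, is_derive m v (fun m' => lcoef (f m') k) (lcoef df k).

Lemma is_dparam_vge a f df :
  is_dparam f df -> (\forall m' \near m, vge a (f m')) -> vge a df.
Proof.
move=> [_ fdf] fa k ka.
have [_ <-] := fdf k.
rewrite (@near_eq_derive _ _ _ _ (cst 0)) ?derive_cst //.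
by near=> m'; suff -> : lcoef (f m') k = 0 by []; move: k ka; near: m'.
Unshelve. all: by end_near. Qed.

Lemma is_dparam_ex f (a : int) : (\forall m' \near m, vge a (f m')) ->
  (forall k, derivable (fun m' => lcoef (f m') k) m v) -> exists df, is_dparam f df.
Proof.
move=> fa fd.
have bd : bounded_below (fun k => 'D_v (fun m' => lcoef (f m') k) m).
  exists a => k ka; rewrite (@near_eq_derive _ _ _ _ (cst 0)) ?derive_cst //.
  by near=> m'; suff -> : lcoef (f m') k = 0 by []; move: k ka; near: m'.
exists (Laurent bd); split=> [|k]; first by exists a.
exact: derivableP.
Unshelve. all: by end_near. Qed.

Lemma dparamE f df : is_dparam f df -> dparam v m f = df.
Proof.
move=> [_ fdf]; apply: laurentP.
have E : (fun k => 'D_v (fun m' => lcoef (f m') k) m) = lcoef df.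
  by apply/funext => k; have [] := fdf k.
by rewrite /dparam lofunE E //; apply: lcoef_bdd.
Qed.

Lemma is_dparam_near f g df :
  (\forall m' \near m, f m' = g m') -> is_dparam f df -> is_dparam g df.
Proof.
move=> fg [[a fa] fdf]; split=> [|k].
  exists a; near=> m'; have <- : f m' = g m' by near: m'.
  by near: m'.
apply: near_eq_is_derive (fdf k).
by near=> m'; suff -> : f m' = g m' by []; near: m'.
Unshelve. all: by end_near. Qed.

Lemma is_dparam_eq f df dg : is_dparam f df -> df = dg -> is_dparam f dg.
Proof. by move=> fdf <-. Qed.

Lemma is_dparam_cst (F : L) : is_dparam (fun=> F) 0.
Proof.
split=> [|k]; last exact: is_derive_cst.
by have [a Fa] := vge_ex F; exists a; near=> m'.
Unshelve. all: by end_near. Qed.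

Lemma is_dparam_lconst c : derivable c m v ->
  is_dparam (fun m' => lconst (c m')) (lconst ('D_v c m)).
Proof.
move=> cd; split=> [|k].
  by exists 0; near=> m'; apply: vge_lconst.
rewrite /=; case: eqP => _; [exact: derivableP | exact: is_derive_cst].
Unshelve. all: by end_near. Qed.

Lemma is_dparamD f g df dg :
  is_dparam f df -> is_dparam g dg -> is_dparam (fun m' => f m' + g m') (df + dg).
Proof.
move=> [[a fa] fdf] [[b gb] gdg]; split=> [|k].
  exists (Num.min a b); near=> m'.
  apply: vgeD; [apply: (@vgeW _ a) | apply: (@vgeW _ b)]; rewrite ?ge_min ?lexx ?orbT //.
    by near: m'.
  by near: m'.
exact: is_deriveD.
Unshelve. all: by end_near. Qed.

Lemma is_dparamN f df : is_dparam f df -> is_dparam (fun m' => - f m') (- df).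
Proof.
move=> [[a fa] fdf]; split=> [|k]; last exact: is_deriveN.
by exists a; near=> m'; apply: vgeN; near: m'.
Unshelve. all: by end_near. Qed.

Lemma is_derive_big n (h : 'I_n -> param S -> C) (d : 'I_n -> C) :
  (forall i, is_derive m v (h i) (d i)) ->
  is_derive m v (fun m' => \sum_(i < n) h i m') (\sum_(i < n) d i).
Proof.
move=> hd; have := is_derive_sum hd.
by congr (is_derive _ _ _ _); apply/funext => m'; rewrite fct_sumE.
Qed.

Lemma is_dparamM f g df dg :
  is_dparam f df -> is_dparam g dg ->
  is_dparam (fun m' => f m' * g m') (df * g m + f m * dg).
Proof.
move=> /[dup] fD [[a fa] fdf] /[dup] gD [[b gb] gdg].
have fga : \forall m' \near m, vge (a + b) (f m' * g m').
  near=> m'; apply: vgeM; near: m'; [exact: fa | exact: gb].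
split=> [|k]; first by exists (a + b).
have dfa := is_dparam_vge fD fa; have dgb := is_dparam_vge gD gb.
have fam := nbhs_singleton fa; have gbm := nbhs_singleton gb.
case: (ltP k (a + b)) => kab.
  rewrite lcoefD (vgeM dfa gbm) // (vgeM fam dgb) // addr0.
  apply: near_eq_is_derive (is_derive_cst 0 _ _).
  by near=> m'; suff -> : lcoef (f m' * g m') k = 0 by []; move: k kab; near: m'.
have -> : k = a + b + (absz (k - (a + b))%R)%:Z by lia.
set n := absz _; rewrite lcoefD (lcoefM _ dfa gbm) (lcoefM _ fam dgb) -big_split.
apply: (@near_eq_is_derive _ _ _ (fun m' => \sum_(i < n.+1)
  (lcoef (f m') (a + i%:Z) * lcoef (g m') (b + (n - i)%N%:Z)))).
  near=> m'; rewrite (@lcoefM _ a b) //; near: m'; [exact: fa | exact: gb].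
apply: is_derive_big => // i.
have := is_deriveM (fdf (a + i%:Z)) (gdg (b + (n - i)%N%:Z)). move=> H; apply: is_derive_eq H _.
by rewrite addrC; congr (_ + _); rewrite mulrC.
Unshelve. all: by end_near. Qed.

Lemma is_dparam_deriv f df : is_dparam f df -> is_dparam (fun m' => lderiv (f m')) (lderiv df).
Proof.
move=> [[a fa] fdf]; split=> [|k].
  by exists (a - 1); near=> m'; apply: vge_deriv; near: m'.
by apply: is_deriveZ.
Unshelve. all: by end_near. Qed.

(* The coefficients of the inverse of a power series are computed recursively. *)
Lemma is_dparamV f df : is_dparam f df ->
  (\forall m' \near m, vge 0 (f m')) -> (\forall m' \near m, lcoef (f m') 0 != 0) ->
  is_dparam (fun m' => (f m')^-1) (- (f m)^-1 * df * (f m)^-1).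
Proof.
move=> fD f0 fn0; have [_ fdf] := fD.
have g0 : \forall m' \near m, vge 0 (f m')^-1.
  by near=> m'; apply: vge_inv; near: m'.
(* Derivability is enough: the value is then forced by differentiating [f * f^-1 = 1]. *)
suff gd k : derivable (fun m' => lcoef (f m')^-1 k) m v.
  have [dg gD] := is_dparam_ex g0 gd.
  apply: (is_dparam_eq gD).
  have fm : f m != 0 by apply/neq0_lcoef0/(nbhs_singleton fn0).
  have fg1 : is_dparam (fun=> 1) (df * (f m)^-1 + f m * dg).
    apply: is_dparam_near (is_dparamM fD gD).
    by near=> m'; rewrite mulfV //; apply: neq0_lcoef0; near: m'.
  have := dparamE fg1; rewrite (dparamE (is_dparam_cst 1)) => dfg.
  have -> : dg = (f m)^-1 * (df * (f m)^-1 + f m * dg) - (f m)^-1 * df * (f m)^-1.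
    by rewrite mulrDr mulKf // mulrA addrAC subrr add0r.
  by rewrite -dfg mulr0 sub0r !mulNr.
case: k => [n|n]; last first.
  apply: near_eq_derivable (derivable_cst 0 _ _).
  near=> m'; suff -> : lcoef (f m')^-1 (Negz n) = 0 by [].
  by have : Negz n < 0 by []; move: (Negz n); near: m'.
elim/ltn_ind: n => n IH.
apply: (@near_eq_derivable _ _ _ (fun m' => (lcoef (f m') 0)^-1 * ((n == 0%N)%:R -
  \sum_(i < n) lcoef (f m') i.+1%:Z * lcoef (f m')^-1 (n - i.+1)%N%:Z))).
  near=> m'.
  have fm0 : vge 0 (f m') by near: m'.
  have fmn : lcoef (f m') 0 != 0 by near: m'.
  have := lcoef1 C n%:Z; rewrite -(mulfV (neq0_lcoef0 fmn)).
  have -> : n%:Z = 0 + 0 + n%:Z by rewrite !add0r.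
  rewrite (lcoefM _ fm0 (vge_inv fm0 fmn)) big_ord_recl !add0r subn0.
  by move=> <-; rewrite addrK mulKf.
apply: derivableM.
  apply: derivableV; first exact: (nbhs_singleton fn0).
  by have [] := fdf 0.
apply: derivableB; first exact: derivable_cst.
pose h (i : 'I_n) m' := lcoef (f m') i.+1%:Z * lcoef (f m')^-1 (n - i.+1)%N%:Z.
suff hd i : is_derive m v (h i) ('D_v (h i) m) by have [] := is_derive_big hd.
apply: derivableP; apply: derivableM; first by have [] := fdf i.+1%:Z.
by apply: IH; have := ltn_ord i; lia.
Unshelve. all: by end_near. Qed.

End Families.

(** * The coordinates q_j, p_j and the openness of the moduli space *)

Section Coordinates.
Variables (R : realType) (nu : nat) (S : setting R nu).
Local Notation C := (Cx R).
Local Notation L := (laurent C).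
Local Notation z := (lvar C).
Implicit Types (m v : param S).

Lemma qc_differentiable j m : differentiable (@qc R nu S j) m.
Proof.
apply: (@differentiable_comp _ _ _ _ (fun m : param S => m.1) (fun q : 'rV[C]_(nq S) => q 0 j)).
  by apply: linear_differentiable => x; apply: cvg_fst.
exact: differentiable_coord.
Qed.

Lemma pc_differentiable j m : differentiable (@pc R nu S j) m.
Proof.
apply: (@differentiable_comp _ _ _ _ (fun m : param S => m.2) (fun q : 'rV[C]_(nq S) => q 0 j)).
  by apply: linear_differentiable => x; apply: cvg_snd.
exact: differentiable_coord.
Qed.

Lemma near_neq (f g : param S -> C) m :
  differentiable f m -> differentiable g m -> f m <> g m -> \forall m' \near m, f m' <> g m'.
Proof.
move=> fd gd fg.
have /differentiable_continuous hc := differentiableB fd gd.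
have : \forall m' \near m, (f - g) m' != 0.
  by apply: cvgr_neq0 hc _; rewrite -[X in X != _]/(f m - g m) subr_eq0; apply/eqP.
by apply: filterS => m' /eqP + fg'; apply; rewrite -[LHS]/(f m' - g m') fg' subrr.
Qed.

(** The hypotheses on the normal forms and solutions hold at points of the moduli space only;
    openness makes them available on a neighbourhood, where identities can be differentiated. *)
Lemma moduli_near m : moduli S m -> \forall m' \near m, moduli S m'.
Proof.
move=> [qq qt]; near=> m'; split.
  near: m'; apply: filter_forall => j; apply: filter_forall => k.
  have [->|jk] := eqVneq j k; first by near=> m'.
  have : qc j m <> qc k m by move=> /qq /eqP; rewrite (negPf jk).
  move=> /(near_neq (qc_differentiable j m) (qc_differentiable k m)).
  by apply: filterS => m' + e.
near: m'; apply: filter_forall => j; apply: filter_forall => i.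
by apply: near_neq (qt j i); first exact: qc_differentiable.
Unshelve. all: by end_near. Qed.

End Coordinates.

(** * Differentiation with x fixed around a moving centre *)

Section Nabla.
Variables (R : realType) (nu : nat) (S : setting R nu).
Local Notation C := (Cx R).
Local Notation L := (laurent C).
Local Notation z := (lvar C).
Variables (v m : param S) (c : param S -> C).
Hypothesis c_der : derivable c m v.
Implicit Types (f g h : param S -> L) (df dg : L) (e : param S -> C).

(* The derivative with x fixed of a series in [z = x - c]. *)
Definition is_nabla f df :=
  exists2 df0, is_dparam v m f df0 & df = df0 - lconst ('D_v c m) * lderiv (f m).

Lemma nablaE f df : is_nabla f df ->
  dparam v m f - lconst ('D_v c m) * lderiv (f m) = df.
Proof. by case=> df0 /dparamE -> ->. Qed.

Lemma is_nabla_unique f df dg : is_nabla f df -> is_nabla f dg -> df = dg.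
Proof. by move=> /nablaE <- /nablaE <-. Qed.

Lemma is_nabla_eq f df dg : is_nabla f df -> df = dg -> is_nabla f dg.
Proof. by move=> fdf <-. Qed.

Lemma is_nabla_near f g df :
  (\forall m' \near m, f m' = g m') -> is_nabla f df -> is_nabla g df.
Proof.
move=> fg [df0 fD ->]; exists df0; first exact: is_dparam_near fD.
by rewrite (nbhs_singleton fg).
Qed.

Lemma is_nabla_vge0 f df : is_nabla f df -> (\forall m' \near m, vge 0 (f m')) -> vge 0 df.
Proof.
move=> [df0 fD ->] f0; apply: vgeB; first exact: (is_dparam_vge fD f0).
apply: vge0M; first exact: vge_lconst.
exact: (vge0_deriv (nbhs_singleton f0)).
Qed.

Lemma is_nabla_lconst e : derivable e m v ->
  is_nabla (fun m' => lconst (e m')) (lconst ('D_v e m)).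
Proof.
move=> ed; exists (lconst ('D_v e m)); first exact: is_dparam_lconst.
by rewrite lderiv_const mulr0 subr0.
Qed.

Lemma is_nabla_cst (a : C) : is_nabla (fun=> lconst a) 0.
Proof.
by exists 0; [exact: is_dparam_cst | rewrite lderiv_const mulr0 subr0].
Qed.

(** Since z = x - c, fixing x makes z vary by the opposite of the variation of the centre. *)
Lemma is_nabla_z : is_nabla (fun=> z) (- lconst ('D_v c m)).
Proof.
by exists 0; [exact: is_dparam_cst | rewrite lderiv_z mulr1 sub0r].
Qed.

(** Treated apart, since the rule [is_nablaV] asks for an invertible power series, and z is none. *)
Lemma is_nabla_Vz : is_nabla (fun=> z^-1) (lconst ('D_v c m) * (z ^+ 2)^-1).
Proof.
exists 0; first exact: is_dparam_cst.
by rewrite lderiv_Vz mulrN opprK add0r.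
Qed.

Lemma is_nablaD f g df dg :
  is_nabla f df -> is_nabla g dg -> is_nabla (fun m' => f m' + g m') (df + dg).
Proof.
move=> [df0 fD ->] [dg0 gD ->]; exists (df0 + dg0); first exact: is_dparamD.
by rewrite lderivD mulrDr opprD addrACA.
Qed.

Lemma is_nablaN f df : is_nabla f df -> is_nabla (fun m' => - f m') (- df).
Proof.
move=> [df0 fD ->]; exists (- df0); first exact: is_dparamN.
by rewrite lderivN mulrN opprD.
Qed.

Lemma is_nablaB f g df dg :
  is_nabla f df -> is_nabla g dg -> is_nabla (fun m' => f m' - g m') (df - dg).
Proof. by move=> fD gD; apply/is_nablaD/is_nablaN. Qed.

Lemma is_nablaM f g df dg :
  is_nabla f df -> is_nabla g dg -> is_nabla (fun m' => f m' * g m') (df * g m + f m * dg).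
Proof.
move=> [df0 fD ->] [dg0 gD ->]; exists (df0 * g m + f m * dg0); first exact: is_dparamM.
by rewrite lderivM mulrBl mulrBr mulrDr opprD addrACA mulrA [in X in _ + X]mulrCA.
Qed.

Lemma is_nabla_sum (I : Type) (r : seq I) (P : pred I) (F : I -> param S -> L) (dF : I -> L) :
  (forall i, P i -> is_nabla (F i) (dF i)) ->
  is_nabla (fun m' => \sum_(i <- r | P i) F i m') (\sum_(i <- r | P i) dF i).
Proof.
move=> FdF; elim: r => [|i r IH].
  rewrite big_nil; apply: is_nabla_near (is_nabla_cst 0).
  by near=> m'; rewrite big_nil rmorph0.
rewrite big_cons; case: ifPn => Pi.
  apply: is_nabla_near (is_nablaD (FdF i Pi) IH).
  by near=> m'; rewrite big_cons Pi.
by apply: is_nabla_near IH; near=> m'; rewrite big_cons (negPf Pi).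
Unshelve. all: by end_near. Qed.

Lemma is_nablaV f df : is_nabla f df ->
  (\forall m' \near m, vge 0 (f m')) -> (\forall m' \near m, lcoef (f m') 0 != 0) ->
  is_nabla (fun m' => (f m')^-1) (- (f m)^-1 * df * (f m)^-1).
Proof.
move=> [df0 fD ->] f0 fn0; exists (- (f m)^-1 * df0 * (f m)^-1); first exact: is_dparamV.
have fm : f m != 0 by apply/neq0_lcoef0/(nbhs_singleton fn0).
rewrite lderivV // mulrBr mulrBl; congr (_ - _).
by rewrite !mulrA !(mulrN, mulNr) ![_ * lconst _]mulrC.
Qed.

Lemma is_nabla_deriv f df : is_nabla f df -> is_nabla (fun m' => lderiv (f m')) (lderiv df).
Proof.
move=> [df0 fD ->]; exists (lderiv df0); first exact: is_dparam_deriv.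
by rewrite lderivB lderivM lderiv_const mul0r add0r.
Qed.

(** This series is x itself. Fixed rational functions of x that are regular at the centre are
    therefore constant for this derivation. *)
Lemma is_nabla_X : is_nabla (fun m' => lconst (c m') + z) 0.
Proof. by apply: is_nabla_eq (is_nablaD (is_nabla_lconst c_der) is_nabla_z) (subrr _). Qed.

Lemma is_nabla_exp0 f n : is_nabla f 0 -> is_nabla (fun m' => f m' ^+ n) 0.
Proof.
move=> fD; elim: n => [|n IH].
  by apply: is_nabla_near (is_nabla_cst 1); near=> m'; rewrite expr0 rmorph1.
apply: is_nabla_near (is_nabla_eq (is_nablaM fD IH) _); last by rewrite mul0r mulr0 addr0.
by near=> m'; rewrite exprS.
Unshelve. all: by end_near. Qed.

Lemma is_nabla_mulC a f : is_nabla f 0 -> is_nabla (fun m' => lconst a * f m') 0.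
Proof.
by move=> fD; apply: is_nabla_eq (is_nablaM (is_nabla_cst a) fD) _; rewrite mul0r mulr0 addr0.
Qed.

Lemma is_nabla_peval (p : {poly C}) f : is_nabla f 0 -> is_nabla (fun m' => peval p (f m')) 0.
Proof.
move=> fD.
have := @is_nabla_sum _ (index_enum 'I_(size p)) xpredT
  (fun i m' => lconst p`_i * f m' ^+ i) (fun=> 0).
rewrite big1_eq => H; apply: is_nabla_near (H _) => [|i _].
  by near=> m'; rewrite /peval horner_coef size_map_poly; apply: eq_bigr => i _; rewrite coef_map.
by apply: is_nabla_mulC; apply: is_nabla_exp0.
Unshelve. all: by end_near. Qed.

Lemma is_nablaV0 f : is_nabla f 0 ->
  (\forall m' \near m, vge 0 (f m')) -> (\forall m' \near m, lcoef (f m') 0 != 0) ->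
  is_nabla (fun m' => (f m')^-1) 0.
Proof.
by move=> fD f0 fn0; apply: is_nabla_eq (is_nablaV fD f0 fn0) _; rewrite mulr0 mul0r.
Qed.

Definition is_nabla_mx (A : param S -> 'M[L]_2) (dA : 'M[L]_2) :=
  forall i j, is_nabla (fun m' => A m' i j) (dA i j).

Lemma nabla_mxE A dA : is_nabla_mx A dA -> dparam_mx_at v m c A = dA.
Proof. by move=> AD; apply/matrixP => i j; rewrite !mxE; apply: nablaE. Qed.

Lemma is_nabla_mx_near A B dA :
  (\forall m' \near m, A m' = B m') -> is_nabla_mx A dA -> is_nabla_mx B dA.
Proof.
move=> AB AD i j; apply: is_nabla_near (AD i j).
by near=> m'; suff -> : A m' = B m' by []; near: m'.
Unshelve. all: by end_near. Qed.

Lemma is_nabla_mxM A B dA dB : is_nabla_mx A dA -> is_nabla_mx B dB ->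
  is_nabla_mx (fun m' => A m' *m B m') (dA *m B m + A m *m dB).
Proof.
move=> AD BD i j.
apply: is_nabla_near (is_nabla_eq (is_nablaD (is_nablaM (AD i 0) (BD 0 j))
  (is_nablaM (AD i 1) (BD 1 j))) _).
  by near=> m'; rewrite mulmx2E.
by rewrite mxE !mulmx2E addrACA.
Unshelve. all: by end_near. Qed.

Lemma is_nabla_mxN A dA : is_nabla_mx A dA -> is_nabla_mx (fun m' => - A m') (- dA).
Proof.
move=> AD i j; rewrite mxE; apply: is_nabla_near (is_nablaN (AD i j)).
by near=> m'; rewrite mxE.
Unshelve. all: by end_near. Qed.

Lemma is_nabla_dmx A dA : is_nabla_mx A dA -> is_nabla_mx (fun m' => dmx (A m')) (dmx dA).
Proof.
move=> AD i j; rewrite mxE; apply: is_nabla_near (is_nabla_deriv (AD i j)).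
by near=> m'; rewrite mxE.
Unshelve. all: by end_near. Qed.

Lemma is_nabla_mx_unique A dA dA' : is_nabla_mx A dA -> is_nabla_mx A dA' -> dA = dA'.
Proof. by move=> AD AD'; apply/matrixP => i j; apply: is_nabla_unique (AD i j) (AD' i j). Qed.

Lemma is_nabla_mx2 f11 f12 f21 f22 d11 d12 d21 d22 :
  is_nabla f11 d11 -> is_nabla f12 d12 -> is_nabla f21 d21 -> is_nabla f22 d22 ->
  is_nabla_mx (fun m' => mx2 (f11 m') (f12 m') (f21 m') (f22 m')) (mx2 d11 d12 d21 d22).
Proof.
move=> D11 D12 D21 D22 i j; rewrite mxE.
have E : (fun m' => mx2 (f11 m') (f12 m') (f21 m') (f22 m') i j) =
    if i == 0 then (if j == 0 then f11 else f12) else (if j == 0 then f21 else f22).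
  by apply/funext => m'; rewrite mxE; case: ifP; case: ifP.
by rewrite E; case: ifP; case: ifP.
Qed.

End Nabla.

(** * Singular points *)

Section SettingFacts.
Variables (R : realType) (nu : nat) (S : setting R nu).

Lemma pord_gt0 i : (0 < pord S i)%N.
Proof.
case: S => t pord k a b c ? ? ? ? kreg knreg /= *.
have := (kreg i, knreg i); case: (k i) => -[kr knr]; first by rewrite kr.
  by apply: ltnW; apply: knr.
by apply: ltnW; apply: knr.
Qed.

Lemma tpos_inj : injective (tpos S). Proof. by case: S. Qed.

Lemma total_orderE : total_order S = (pord S None + \sum_(i < nu) pord S (Some i))%N.
Proof.
rewrite /total_order (bigD1 None) //=; congr (_ + _)%N.
rewrite (reindex_omap Some id) => [|[]//].
by apply: eq_bigl => i /=; rewrite eqxx.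
Qed.

Lemma total_order_gt1 : (1 < total_order S)%N.
Proof.
have nu2 : (2 <= nu)%N by case: S.
rewrite total_orderE (leq_trans _ (leq_addl _ _)) // -[X in (X < _)%N]muln1.
apply: leq_trans nu2 _; rewrite -[X in (X <= _)%N]card_ord -sum1_card.
by apply: leq_sum => i _; apply: pord_gt0.
Qed.

End SettingFacts.

Section SingularPoints.
Variables (R : realType) (nu : nat) (S : setting R nu).
Local Notation C := (Cx R).
Local Notation L := (laurent C).
Local Notation z := (lvar C).
Implicit Types (m v : param S) (F : param S -> nform R nu) (f : L).

Lemma lcoef_XC0 (a : C) : lcoef (lconst a + z) 0 = a.
Proof. by rewrite lcoefD lcoef_lconst0 addr0. Qed.

Lemma vge0_XC (a : C) : vge 0 (lconst a + z).
Proof. by apply: vgeD; [exact: vge_lconst | exact: vge0_z]. Qed.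

Lemma XC_neq0 (a : C) : lconst a + z != 0.
Proof.
apply/eqP => /(congr1 (fun f => lcoef f 1)); rewrite lcoefD lcoef0 /= add0r.
by move=> e10; have := oner_neq0 C; rewrite -e10 eqxx.
Qed.

Lemma XBC (a b : C) : lconst a + z - lconst b = lconst (a - b) + z.
Proof. by rewrite addrAC -rmorphB. Qed.

Lemma vge0_VXC (a b : C) : a <> b -> vge 0 (lconst a + z - lconst b)^-1.
Proof.
move=> ab; rewrite XBC; apply: vge_inv; first exact: vge0_XC.
by rewrite lcoef_XC0 subr_eq0; apply/eqP.
Qed.

Lemma vge1_VzB (a : C) : vge 1 (z^-1 - lconst a)^-1.
Proof.
have -> : (z^-1 - lconst a)^-1 = z * (1 - lconst a * z)^-1.
  have -> : 1 - lconst a * z = z * (z^-1 - lconst a).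
    by rewrite mulrBr mulfV ?z_neq0 // mulrC.
  by rewrite invfM mulVKf // z_neq0.
have e0 : vge 0 (1 - lconst a * z).
  by apply: vgeB; [exact: vge1 | apply: vge0M; [exact: vge_lconst | exact: vge0_z]].
rewrite -[X in vge X](addr0 1); apply: vgeM; first exact: vge_z.
apply: vge_inv e0 _.
by rewrite lcoefB lcoef1 lcoef_lconstM mulr0 subr0 oner_eq0.
Qed.

Lemma VzB_neq0 (a : C) : z^-1 - lconst a != 0.
Proof.
apply/eqP => /(congr1 (fun f => lcoef f (-1))).
rewrite lcoefB -[z^-1]mulr1 lcoef_VzM lcoef1 lcoef0 /= subr0.
by move=> e10; have := oner_neq0 C; rewrite -e10 eqxx.
Qed.

Lemma peval_Ppoly X :
  peval (Ppoly S) X = \prod_(i < nu) (X - lconst (tpos S i)) ^+ pord S (Some i).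
Proof.
rewrite /Ppoly peval_prod; apply: eq_bigr => i _.
by rewrite pevalXn pevalB pevalX pevalC.
Qed.

Lemma peval_Ppoly_fin (a : 'I_nu) :
  peval (Ppoly S) (lconst (tpos S a) + z) != 0 /\
  vge (pord S (Some a))%:Z (peval (Ppoly S) (lconst (tpos S a) + z)).
Proof.
rewrite peval_Ppoly; split.
  by apply/prodf_neq0 => i _; rewrite XBC expf_neq0 // XC_neq0.
rewrite (bigD1 a) //= -[X in vge X]addr0; apply: vgeM.
  by rewrite XBC subrr rmorph0 add0r -[X in vge X]mul1r; apply/vgeX/vge_z.
elim/big_ind: _ => [||i _]; [exact: vge1 | exact: vge0M |].
by apply: vge0X; rewrite XBC; apply: vge0_XC.
Qed.

Lemma peval_Ppoly_inf :
  peval (Ppoly S) z^-1 != 0 /\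
  vge (- (\sum_(i < nu) pord S (Some i))%N%:Z) (peval (Ppoly S) z^-1).
Proof.
rewrite peval_Ppoly; split.
  by apply/prodf_neq0 => i _; rewrite expf_neq0 // VzB_neq0.
rewrite raddf_sum /= -sumrN; elim/big_rec2: _ => [|i y x _ xy]; first exact: vge1.
apply: vgeM => //; rewrite -mulN1r; apply: vgeX; apply: vgeB; first exact: vge_Vz.
by apply: vgeW (vge_lconst _).
Qed.

(** Brings the matrix on U_oo to the shape of those at the finite points, with vanishing upper-left
    entry, so that one argument serves all t_i. *)
Lemma Omega_at_infE (G : nform R nu) m :
  let e := z^-1 ^+ (total_order S - 2) in
  Omega_at G m None =
  mx2 0 (lderiv z^-1 * (peval (Ppoly S) z^-1)^-1 * e)
    (e^-1 * (lderiv z^-1 * c0 G m z^-1)) (e^-1 * lderiv e + lderiv z^-1 * d0 G m z^-1).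
Proof.
move=> e; have e0 : e != 0 by rewrite expf_neq0 // invr_neq0 // z_neq0.
have -> : Omega_at G m None = gauge (diag2 1 e) (lderiv z^-1 *: Omega G m z^-1) by [].
have inve : invmx (diag2 1 e) = diag2 1 e^-1.
  apply: invmx_eq; apply: eq_mx2;
  by rewrite !mulmx2E !mx2E !mxE /= ?(mulr0, mul0r, addr0, add0r, mulr1) ?mulfV.
have d1 : lderiv (1 : L) = 0 by rewrite -(rmorph1 (@lconst C)) lderiv_const.
have d0' : lderiv (0 : L) = 0 by rewrite -[X in lderiv X](rmorph0 (@lconst C)) lderiv_const.
rewrite /gauge inve /Omega; apply: eq_mx2;
  rewrite mxE !mulmx2E !mx2E !mxE /= ?d1 ?d0' ?(mulr0, mul0r, addr0, add0r, mulr1, mul1r) //.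
by rewrite mulrAC mulVf // mul1r.
Qed.

(** These are the conditions that [polar_parts_eq] puts on the first row: the upper-right entry has
    a pole of order at least n_i. *)
Lemma Omega_at_01 (G : nform R nu) m i :
  [/\ Omega_at G m i 0 0 = 0, Omega_at G m i 0 1 != 0 &
      vge (pord S i)%:Z (Omega_at G m i 0 1)^-1].
Proof.
case: i => [a|]; first by rewrite !mx2E invrK invr_eq0; have [] := peval_Ppoly_fin a.
rewrite Omega_at_infE !mx2E; have [P0 Pv] := peval_Ppoly_inf.
have Vz0 : z^-1 != 0 :> L by rewrite invr_neq0 // z_neq0.
have lz : (lderiv z^-1)^-1 = - (z ^+ 2) :> L by rewrite lderiv_Vz invrN invrK.
have lz0 : lderiv z^-1 != 0 :> L.
  by rewrite -invr_eq0 lz oppr_eq0 expf_neq0 // z_neq0.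
split=> //; first by rewrite !mulf_neq0 // ?invr_eq0 // expf_neq0.
rewrite !invfM lz invrK -exprVn invrK.
set n := total_order S; set k := (\sum_(i < nu) _)%N in Pv.
(* For the inverse of the entry: dx = -dw/w^2 contributes the order 2, P contributes minus the sum
   of the finite n_i, and the transition matrix contributes n - 2. The total is n_oo. *)
have -> : (pord S None)%:Z = (2 + - k%:Z) + (n - 2)%N%:Z.
  have := total_orderE S; have := total_order_gt1 S; rewrite -/n -/k; lia.
apply: vgeM; last by rewrite -[X in vge X]mul1r; apply/vgeX/vge_z.
by apply: vgeM => //; apply/vgeN; apply: (@vgeX _ 1 z 2 (@vge_z _)).
Qed.

Lemma vge_unramified_form n (a b : nat -> C) :
  mx_vge (- n%:Z) (\sum_(l < n) z ^ (l%:Z - n%:Z) *: cmx (diag2 (a l) (b l))).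
Proof.
apply: mx_vge_sum => l _; apply: (@mx_vgeW _ (l%:Z - n%:Z + 0)); first lia.
by apply: mx_vgeZ; [exact: vge_zexp | exact: mx_vge_cmx].
Qed.

Lemma vge_ramified_block n (al be : L) : (0 < n)%N ->
  vge (- n%:Z) al -> vge (- n%:Z) be -> mx_vge (- n%:Z) (ramified_block al be).
Proof.
move=> n0 aln ben; apply: mx_vge2 => //.
  by apply: (@vgeW _ (1 - n%:Z)); [lia | apply: vgeM => //; apply: vge_z].
apply: vgeB => //; rewrite invfM -(rmorph_nat (@lconst C)) -fmorphV.
apply: (@vgeW _ (0 + - 1)); first lia.
by apply: vgeM; [exact: vge_lconst | exact: vge_Vz].
Qed.

Lemma vge_ramified_form n (a : nat -> C) : (0 < n)%N ->
  mx_vge (- n%:Z) (ramified_block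
      (\sum_(l < n) lconst (a (2 * l)%N / 2%:R) * z ^ (l%:Z - n%:Z))
      (\sum_(l < n.-1) lconst (a (2 * l + 1)%N / 2%:R) * z ^ (l%:Z - n%:Z))).
Proof.
move=> n0; apply: vge_ramified_block => //; apply: vge_sum => l _;
  (apply: (@vgeW _ (0 + (l%:Z - n%:Z))); first lia);
  by apply: vgeM; [exact: vge_lconst | exact: vge_zexp].
Qed.

Lemma Omega_at_polar (G G' : nform R nu) m m' i :
  local_data S (Omega_at G m i) i -> local_data S (Omega_at G' m' i) i ->
  mx_vge 0 (Omega_at G' m' i - Omega_at G m i).
Proof.
have [A00 A01 A01v] := Omega_at_01 G m i; have [A00' _ _] := Omega_at_01 G' m' i.
have eA : Omega_at G m i 0 1 = Omega_at G' m' i 0 1.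
  by case: i {A00 A01 A01v A00'} => [a|]; rewrite ?Omega_at_infE !mx2E.
have nz2 : (2%:R : C) != 0 by rewrite pnatr_eq0.
rewrite /local_data.
case: (is_ramified (kind S i)) => -[M MG MA] [M' MG' MA'].
  exact: (polar_parts_eq nz2 MG MG' (vge_ramified_form _ (pord_gt0 S i)) MA MA' A00 A00' eA A01).
exact: (polar_parts_eq nz2 MG MG' (vge_unramified_form _ _) MA MA' A00 A00' eA A01).
Qed.

Lemma vge0_fin_term (p : {poly C}) n (a b : C) : a <> b ->
  vge 0 (peval p (lconst a + z) / (lconst a + z - lconst b) ^+ n).
Proof.
move=> ab; apply: vge0M; first exact/vge0_peval/vge0_XC.
by rewrite -exprVn; apply/vge0X/vge0_VXC.
Qed.

(** Isolates a numerator in the difference of two values of [d0]: [u] is the power of x - t_i below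
    it, [s] the sum over the other t_k, [r] the sum over the q_j and [t] the polynomial part. *)
Lemma polar_term_eq (K : fieldType) (p p' u s s' r r' t t' : K) : u != 0 ->
  p' - p = u * ((p' / u + s' - r' + t') - (p / u + s - r + t) - (s' - s) + (r' - r) - (t' - t)).
Proof. by move=> u0; field. Qed.

(** All terms of [d0] other than the one at t_i are regular there, so its polar part determines D_i.
    Consequently [d0] depends on the parameters through the q_j only, which makes it
    differentiable. *)
Lemma nfD_polar (G G' : nform R nu) m m' :
  is_normal_form m G -> is_normal_form m' G' -> moduli S m -> moduli S m' ->
  (forall i, nfD G' i = nfD G i) /\ nfDinf G' = nfDinf G.
Proof.
move=> [[_ szD _ szDi _] _ lG] [[_ szD' _ szDi' _] _ lG'] [_ qt] [_ qt'].
have polar i := Omega_at_polar (lG i) (lG' i).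
have DE a : nfD G' a = nfD G a.
  have := polar (Some a) 1 1; rewrite mxE [X in _ + X]mxE !mx2E /d0.
  set X := lconst (tpos S a) + z; rewrite (bigD1 a) // [in X in _ - X](bigD1 a) //=.
  set s' := \sum_(i < nu | _) _; set r' := \sum_(j < nq S) _.
  set s := \sum_(i < nu | _) _; set r := \sum_(j < nq S) _.
  set n := pord S (Some a); have X0 : vge 0 X by exact: vge0_XC.
  have s0 : vge 0 (s' - s).
    by apply: vgeB; apply: vge_sum => i ia; apply: vge0_fin_term => /tpos_inj /eqP;
      rewrite eq_sym (negPf ia).
  have r0 : vge 0 (r' - r).
    by apply: vgeB; apply: vge_sum => j _; apply: vge0_VXC => e;
      [apply: (qt' j a) | apply: (qt j a)].
  move=> dd; apply/eqP; rewrite -subr_eq0; apply/eqP.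
  apply: (@peval_shift_eq0 _ _ (tpos S a) n).
    by rewrite (leq_trans (size_polyD _ _)) // size_polyN geq_max szD' szD.
  have u0 : (X - lconst (tpos S a)) ^+ n != 0 by rewrite XBC expf_neq0 // XC_neq0.
  rewrite pevalB (polar_term_eq _ _ s s' r r' (peval (nfDinf G) X) (peval (nfDinf G') X) u0).
  rewrite -[X in vge X]addr0; apply: vgeM.
    by rewrite XBC subrr rmorph0 add0r; have := @vgeX _ 1 z n (@vge_z _); rewrite mul1r.
  apply: vgeB; last by apply: vgeB; apply: vge0_peval.
  by apply: vgeD => //; apply: vgeB.
(* At infinity the sums over the t_i now agree and cancel, and those over the q_j vanish at
   infinity; what is left of the difference is a polynomial in 1/w, to be shown of positive
   order. *)
split=> //; apply/eqP; rewrite -subr_eq0; apply/eqP/peval_inv_eq0.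
have := polar None 1 1; rewrite !Omega_at_infE mxE [X in _ + X]mxE !mx2E /d0.
under eq_bigr => i _ do rewrite DE.
set r' := \sum_(j < nq S) _; set s := \sum_(i < nu) _; set r := \sum_(j < nq S) _.
rewrite opprD addrACA subrr add0r -mulrBr => dd.
have lz0 : lderiv z^-1 != 0 :> L by rewrite lderiv_Vz oppr_eq0 invr_eq0 expf_neq0 // z_neq0.
(* The factor dx = -dw/w^2 in the matrix turns a holomorphic difference of entries into a zero of
   order 2 of the difference of the functions [d0]. *)
have d2 : vge 2 (s - r' + peval (nfDinf G') z^-1 - (s - r + peval (nfDinf G) z^-1)).
  rewrite -(mulKf lz0 (_ - _)) -[X in vge X]addr0; apply: vgeM => //.
  by rewrite lderiv_Vz invrN invrK; apply/vgeN/(@vgeX _ 1 z 2 (@vge_z _)).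
have -> : peval (nfDinf G' - nfDinf G) z^-1 =
    (s - r' + peval (nfDinf G') z^-1 - (s - r + peval (nfDinf G) z^-1)) + (r' - r).
  by rewrite pevalB; move: (peval _ _) (peval _ _) => t t'; ring.
apply: vgeD; first exact: vgeW d2.
by apply: vgeB; apply: vge_sum => j _; apply: vge1_VzB.
Qed.

End SingularPoints.

(** * Vanishing of the residues at the points t_i *)

Section SingularResidues.
Variables (R : realType) (nu : nat) (S : setting R nu).
Local Notation C := (Cx R).
Local Notation L := (laurent C).
Local Notation z := (lvar C).
Variables (F : param S -> nform R nu) (Y : solutions S) (m : param S).
Hypothesis F_normal : forall m, moduli S m -> is_normal_form m (F m).
Hypothesis m_moduli : moduli S m.
Implicit Types (v : param S) (i : sing nu).

Lemma res_tr_wedge_eq0 a b (A1 A2 B1 B2 : 'M[L]_2) : 0 <= a + b ->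
  mx_vge a A1 -> mx_vge a A2 -> mx_vge b B1 -> mx_vge b B2 -> res_tr_wedge A1 A2 B1 B2 = 0.
Proof.
move=> ab A1a A2a B1b B2b; apply/lres_vge0/vge_mxtrace/mx_vgeB; apply: mx_vgeW ab _.
  exact: mx_vgeM.
by rewrite addrC; apply: mx_vgeM.
Qed.

Lemma dparam_mx_vge v a (A : param S -> 'M[L]_2) :
  (\forall m' \near m, mx_vge a (A m' - A m)) -> mx_vge a (dparam_mx v m A).
Proof.
move=> Aa i j; rewrite mxE; apply: dparam_vge.
by apply: filterS Aa => m' /(_ i j); rewrite !mxE.
Qed.

(** The terms of index at least [n] have nonnegative exponent, hence primitives without pole. So the
    principal part of an exponent involves only the prescribed theta, which are constant. *)
Lemma fp_int_lseries_eq (K : fieldType) a (G H : nat -> K) n :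
  0 <= a + n%:Z -> (forall l, (l < n)%N -> G l = H l) ->
  vge 0 (fp_reg (fp_int (lseries a G)) - fp_reg (fp_int (lseries a H))).
Proof.
move=> an GH k k0; rewrite lcoefB /= lt_eqF //.
suff -> : shifted a G (k - 1) = shifted a H (k - 1) by rewrite subrr.
rewrite /shifted; case: leP => // ak; apply: GH; lia.
Qed.

(** The variations of the amplitude and of the exponents are power series, so a pole can come only
    from the inverse of the amplitude. There is none in the unramified case, and at most a simple
    one, due to [invmx (Mzeta C)], in the ramified case. *)
Lemma dlog_fsol_vge v a (psi : param S -> fsol C) :
  (\forall m' \near m, mx_vge 0 (amp (psi m'))) -> mx_vge a (invmx (amp (psi m))) ->
  (\forall m' \near m, vge 0 (fp_reg (expo (psi m')).1 - fp_reg (expo (psi m)).1)) ->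
  (\forall m' \near m, vge 0 (fp_reg (expo (psi m')).2 - fp_reg (expo (psi m)).2)) ->
  mx_vge a (dlog_fsol v m psi).
Proof.
move=> amp0 inva e1 e2; have ampm := nbhs_singleton amp0.
rewrite /dlog_fsol -[X in mx_vge X]add0r; apply: mx_vgeM inva; apply: mx_vgeB.
  apply: dparam_mx_vge; apply: filterS amp0 => m' ?; exact: mx_vgeB.
apply: mx_vge0M => //; apply: mx_vge2 => //; exact: dparam_vge.
Qed.

Lemma Omega_at_near i : \forall m' \near m, mx_vge 0 (Omega_at (F m') m' i - Omega_at (F m) m i).
Proof.
apply: filterS (moduli_near m_moduli) => m' m'M.
by have [_ _ l] := F_normal m_moduli; have [_ _ l'] := F_normal m'M; apply: Omega_at_polar.
Qed.

Lemma GL2_series_amp (A : 'M[C]_2) (X : 'M[L]_2) :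
  A \in unitmx -> series_mx X -> coef_mx X 0 = 1%:M -> GL2_series (cmx A *m X).
Proof.
move=> Au X0 X1; apply: GL2_seriesM; first exact: GL2_series_cmx.
split=> //; have Xc a b : lcoef (X a b) 0 = (a == b)%:R.
  by have := congr1 (fun B : 'M_2 => B a b) X1; rewrite !mxE.
have V a b : vge 0 (X a b) by exact: X0.
by rewrite det2E lcoefB !(lcoefM0 (V _ _) (V _ _)) !Xc mulr0 subr0 mulr1 oner_neq0.
Qed.

Lemma res_unramified_eq0 v1 v2 i : unramified_solution F Y i ->
  let A := fun m' => Omega_at (F m') m' i in
  res_tr_wedge (dparam_mx v1 m A) (dparam_mx v2 m A)
    (dlog_fsol v1 m (psi_unr Y i)) (dlog_fsol v2 m (psi_unr Y i)) = 0.
Proof.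
move=> [PhiU sol] A.
have dA v : mx_vge 0 (dparam_mx v m A) by apply/dparam_mx_vge/Omega_at_near.
have dlog v : mx_vge 0 (dlog_fsol v m (psi_unr Y i)).
  have [_ thE [X0 X1] _ _] := sol m m_moduli.
  have near_sol := moduli_near m_moduli.
  apply: dlog_fsol_vge.
  - apply: filterS near_sol => m' /sol [_ _ [X0' X1'] _ _].
    by have [] := GL2_series_amp PhiU X0' X1'.
  - by apply/GL2_series_inv/GL2_series_amp.
  - apply: filterS near_sol => m' /sol [_ thE' _ _ _].
    apply: (@fp_int_lseries_eq _ _ _ _ (pord S i)); first lia.
    by move=> l li; have [-> _] := thE' l li; have [-> _] := thE l li.
  - apply: filterS near_sol => m' /sol [_ thE' _ _ _].
    apply: (@fp_int_lseries_eq _ _ _ _ (pord S i)); first lia.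
    by move=> l li; have [_ ->] := thE' l li; have [_ ->] := thE l li.
exact: (@res_tr_wedge_eq0 0 0).
Qed.

Lemma vge_lsq (f : L) a : vge a f -> vge (2 * a) (lsq f).
Proof. by move=> fa k ka /=; case: ifP => // _; apply: fa; lia. Qed.

Lemma lcoef0_lsq (f : L) : lcoef (lsq f) 0 = lcoef f 0.
Proof. by []. Qed.

Lemma lsqB (f g : L) : lsq (f - g) = lsq f - lsq g.
Proof. by apply: laurent_ext => k; rewrite lcoefB /=; case: ifP; rewrite ?subr0. Qed.

Lemma pullback_vge1 (A B : 'M[L]_2) : mx_vge 0 (A - B) -> mx_vge 1 (pullback A - pullback B).
Proof.
move=> AB i j.
have -> : (pullback A - pullback B) i j = lderiv (z ^+ 2) * lsq ((A - B) i j).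
  by rewrite !mxE -mulrBr -lsqB.
rewrite -[X in vge X]addr0; apply: vgeM; first exact: (@vge_deriv _ 2 _ (@vgeX _ 1 z 2 (@vge_z _))).
by have := @vge_lsq _ 0 (AB i j).
Qed.

Lemma Mzeta_unit : Mzeta C \in unitmx.
Proof.
rewrite unitmxE unitfE det2E !mx2E !mul1r -opprD oppr_eq0 -mulr2n -mulr_natl mulf_neq0 ?z_neq0 //.
by rewrite -(rmorph_nat (@lconst C)) fmorph_eq0 pnatr_eq0.
Qed.

Lemma invmx_Mzeta_vge : mx_vge (-1) (invmx (Mzeta C)).
Proof.
have nz2 : (2%:R : L) != 0 by rewrite -(rmorph_nat (@lconst C)) fmorph_eq0 pnatr_eq0.
pose c : L := lconst 2%:R^-1; have c2 : c * 2%:R = 1.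
  by rewrite /c fmorphV rmorph_nat mulVf.
have -> : invmx (Mzeta C) = mx2 c (c * z^-1) c (- (c * z^-1)).
  have cc : c + c = 1 by rewrite -c2 mulr_natr mulr2n.
  have zc : z * (c * z^-1) = c by rewrite mulrCA mulfV ?z_neq0 ?mulr1.
  by apply/invmx_eq/eq_mx2;
    rewrite mulmx2E !mx2E !mxE /= ?(mul1r, mulNr, mulrN, opprK) ?zc ?subrr.
have c0 : vge (-1) c by apply: vgeW (vge_lconst _).
have cz : vge (-1) (c * z^-1).
  by rewrite -[X in vge X]add0r; apply: vgeM; [exact: vge_lconst | exact: vge_Vz].
by apply: mx_vge2 => //; apply: vgeN.
Qed.

Lemma res_ramified_eq0 v1 v2 i : ramified_solution F Y i ->
  let A := fun m' => pullback (Omega_at (F m') m' i) in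
  res_tr_wedge (dparam_mx v1 m A) (dparam_mx v2 m A)
    (dlog_fsol v1 m (psi_ram Y i)) (dlog_fsol v2 m (psi_ram Y i)) = 0.
Proof.
move=> [PhiU sol] A.
have dA v : mx_vge 1 (dparam_mx v m A).
  by apply/dparam_mx_vge; apply: filterS (Omega_at_near i) => m'; apply: pullback_vge1.
have n0 := pord_gt0 S i.
have lsqX (X : 'M[L]_2) : series_mx X -> coef_mx X 0 = 1%:M ->
    series_mx (map_mx (@lsq C) X) /\ coef_mx (map_mx (@lsq C) X) 0 = 1%:M.
  move=> X0 X1; split; last by rewrite -X1; apply/matrixP => a b; rewrite !mxE lcoef0_lsq.
  by move=> a b; rewrite mxE; have := @vge_lsq _ 0 (X0 a b).
have dlog v : mx_vge (-1) (dlog_fsol v m (psi_ram Y i)).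
  have [_ thE [X0 X1] _ _] := sol m m_moduli.
  have near_sol := moduli_near m_moduli.
  have [X0' X1'] := lsqX _ X0 X1; have G := GL2_series_amp PhiU X0' X1'.
  apply: dlog_fsol_vge.
  - apply: filterS near_sol => m' /sol [_ _ [W0 W1] _ _].
    have [W0' W1'] := lsqX _ W0 W1; have [G0 _] := GL2_series_amp PhiU W0' W1'.
    apply: mx_vge0M => //; apply: mx_vge2; [exact: vge1 | exact: vge1 | exact: vge0_z |].
    exact/vgeN/vge0_z.
  - have -> : invmx (amp (psi_ram Y i m)) =
        invmx (Mzeta C) *m invmx (cmx (Phi Y i) *m map_mx (@lsq C) (Xi Y m i)).
      by rewrite -invmxM //; [exact: GL2_series_unit | exact: Mzeta_unit].
    rewrite -[X in mx_vge X]addr0; apply: mx_vgeM; last exact: GL2_series_inv.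
    exact: invmx_Mzeta_vge.
  - apply: filterS near_sol => m' /sol [_ thE' _ _ _].
    (* The integrand starts at order 1 - 2 n_i in zeta, and the prescribed theta_{l'} are those with
       l' <= 2 n_i - 2: both give the bound 2 n_i - 1. *)
    apply: (@fp_int_lseries_eq _ _ _ _ (2 * pord S i - 1)); first lia.
    by move=> l li; rewrite thE' ?thE //; lia.
  - apply: filterS near_sol => m' /sol [_ thE' _ _ _].
    apply: (@fp_int_lseries_eq _ _ _ _ (2 * pord S i - 1)); first lia.
    by move=> l li; rewrite thE' ?thE //; lia.
exact: (@res_tr_wedge_eq0 1 (-1)).
Qed.

End SingularResidues.

(** * Apparent singularities *)

(* [U] stands for delta(psi) psi^{-1} and [A] for delta(Omega) at an apparent
   singularity; [V0] and [V1] are the entries (0,1) and (1,1) of V = delta(Y) Y^{-1}, and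
   the connection in the holomorphic frame is [p * u, z * u; ep, dl], with u = 1/P. *)
Section ResidueIdentity.
Variables (K : fieldType).
Local Notation L := (laurent K).
Local Notation z := (lvar K).
Variables (p u dl ep : L).

(** The data of one tangent vector: [a] and [b] are the variations of p_j and q_j, [h] that of the
    regular part of [d0], [e] that of [ep]. The series [r0] and [r1] collect what is multiplied by z
    in V', and so does not reach the residue. *)
Definition apparent_variation (a b h : L) (A U : 'M[L]_2) : Prop :=
  exists V0 V1 e r0 r1 : L,
  [/\ [/\ vge 0 V0, vge 0 V1, vge 0 e, vge 0 r0 & vge 0 r1],
      lderiv V0 = b * u + V0 * (dl - p * u) + z * r0 /\
      lderiv V1 = a * u - ep * V0 - h + z * r1,
      U 0 1 = V0 / z /\ U 1 1 = (p * V0 - b) / z + V1,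
      A 0 0 = 0 /\ A 0 1 = 0 &
      A 1 1 = h - b / z ^+ 2 /\
      A 1 0 = a / z + a * (p * u - dl) - b * ep + z * e - p * A 1 1].

(** The triple pole [b1 * b2 / z' ^+ 3] cancels by antisymmetry, and the terms [p * A 1 1] in
    [A 1 0] cancel against [p * V0] in [U 1 1]. At most a double pole remains. *)
Lemma trace_variationE (a1 a2 b1 b2 h1 h2 V1 V2 W1 W2 e1 e2 z' : L) : z' != 0 ->
  (a1 / z' + a1 * (p * u - dl) - b1 * ep + z' * e1 - p * (h1 - b1 / z' ^+ 2)) * (V2 / z')
   + (h1 - b1 / z' ^+ 2) * ((p * V2 - b2) / z' + W2)
   - (V1 / z' * (a2 / z' + a2 * (p * u - dl) - b2 * ep + z' * e2 - p * (h2 - b2 / z' ^+ 2))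
      + ((p * V1 - b1) / z' + W1) * (h2 - b2 / z' ^+ 2)) =
  z'^-1 * (z'^-1 * (a1 * V2 - a2 * V1 - b1 * W2 + b2 * W1))
  + z'^-1 * ((a1 * (p * u - dl) - b1 * ep) * V2 - (a2 * (p * u - dl) - b2 * ep) * V1
             - h1 * b2 + h2 * b1)
  + (e1 * V2 - e2 * V1 + h1 * W2 - h2 * W1).
Proof. by move=> z0; field. Qed.

(** The double pole brings in f'(0): this is where the differential equations of [V0] and [V1] are
    needed. *)
Lemma lres_laurent (f g h : L) : vge 0 h ->
  lres (z^-1 * (z^-1 * f) + z^-1 * g + h) = lcoef (lderiv f + g) 0.
Proof.
move=> h0; rewrite !lresD (lres_vge0 h0) addr0 lcoefD.
by rewrite /lres !lcoef_VzM lcoef_deriv add0r mul1r.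
Qed.

Lemma apparent_residue (a1 a2 b1 b2 : K) (h1 h2 : L) (A1 A2 U1 U2 : 'M[L]_2) :
  vge 0 h1 -> vge 0 h2 ->
  apparent_variation (lconst a1) (lconst b1) h1 A1 U1 ->
  apparent_variation (lconst a2) (lconst b2) h2 A2 U2 ->
  lres (\tr (A1 *m U2 - U1 *m A2)) =
  2%:R * ((a1 * b2 - a2 * b1) * lcoef u 0 + b1 * lcoef h2 0 - b2 * lcoef h1 0).
Proof.
move=> h10 h20.
move=> [V1 [W1 [e1 [r1 [s1 [[V10 W10 e10 r10 s10]]]]]]].
move=> [dV1 dW1] [U101 U111] [A100 A101] [A111 A110].
move=> [V2 [W2 [e2 [r2 [s2 [[V20 W20 e20 r20 s20]]]]]]].
move=> [dV2 dW2] [U201 U211] [A200 A201] [A211 A210].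
have -> : \tr (A1 *m U2 - U1 *m A2) =
    A1 1 0 * U2 0 1 + A1 1 1 * U2 1 1 - (U1 0 1 * A2 1 0 + U1 1 1 * A2 1 1).
  by rewrite raddfB /= !mxtrace2E !mulmx2E A100 A101 A200 A201 !(mul0r, mulr0, add0r).
rewrite A110 A111 A210 A211 U101 U111 U201 U211 trace_variationE ?z_neq0 //.
rewrite lres_laurent; last by do ![apply: vgeB | apply: vgeD | apply: vge0M].
have -> : lderiv (lconst a1 * V2 - lconst a2 * V1 - lconst b1 * W2 + lconst b2 * W1)
    = lconst a1 * lderiv V2 - lconst a2 * lderiv V1 - lconst b1 * lderiv W2 + lconst b2 * lderiv W1.
  by rewrite !(lderivD, lderivN, lderivM, lderiv_const, mul0r, add0r).
rewrite dV1 dV2 dW1 dW2.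
(* After substitution the terms in V cancel between f' and g, up to multiples of z. The term in [u]
   comes once from [V0] and once from [V1], the terms in [h] once from [V1] and once from g, hence
   the factor 2. *)
rewrite [X in lcoef X](_ : _ =
    z * (lconst a1 * r2 - lconst a2 * r1 - lconst b1 * s2 + lconst b2 * s1)
    + lconst 2%:R * (lconst (a1 * b2 - a2 * b1) * u + lconst b1 * h2 - lconst b2 * h1)); last first.
  rewrite rmorph_nat rmorphB !rmorphM /=.
  move: (lconst a1) (lconst a2) (lconst b1) (lconst b2) => c1 c2 d1 d2; ring.
rewrite lcoefD lcoef_zM [X in X + _](_ : _ = 0); last first.
  by do ![apply: vgeB | apply: vgeD | apply: vge0M | apply: vge_lconst].
by rewrite add0r lcoef_lconstM lcoefB lcoefD !lcoef_lconstM.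
Qed.

End ResidueIdentity.

(** * Matrix identities in the frame Phi *)

Section ApparentFrame.
Variable K : fieldType.
Local Notation L := (laurent K).
Local Notation z := (lvar K).
Implicit Types (w : K) (u c d : L).

Lemma invmx_frame w : invmx (mx2 1 0 (lconst w) z) = mx2 1 0 (- (lconst w / z)) z^-1.
Proof.
apply: invmx_eq; apply: eq_mx2;
  rewrite mulmx2E !mx2E !mxE /= ?(mul1r, mulr0, mulr1, mul0r, addr0, add0r) //.
  by rewrite mulrN mulrCA mulfV ?z_neq0 // mulr1 subrr.
by rewrite mulfV ?z_neq0.
Qed.

Lemma frame_unit w : mx2 1 0 (lconst w) z \in unitmx.
Proof. by rewrite unitmxE unitfE det2E !mx2E mul1r mul0r subr0 z_neq0. Qed.

(** The term [z^-1] in the last entry cancels the pole of [d0] at q_j; for holomorphic [u], only the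
    lower-left entry is then not visibly holomorphic. *)
Lemma gauge_frame w u c d :
  gauge (mx2 1 0 (lconst w) z) (mx2 0 u c d) =
  mx2 (lconst w * u) (z * u) (z^-1 * (c + lconst w * d - lconst w ^+ 2 * u))
      (d + z^-1 - lconst w * u).
Proof.
have z0 := z_neq0 K.
have dPhi : dmx (mx2 1 0 (lconst w) z) = mx2 0 0 0 1.
  by apply: eq_mx2; rewrite [LHS]mxE !mx2E ?lderiv_const ?lderiv_z // -?(rmorph1 (@lconst K))
    -?(rmorph0 (@lconst K)) lderiv_const ?rmorph0.
rewrite /gauge invmx_frame dPhi; move: (lconst w) => w'.
apply: eq_mx2; rewrite mxE !mulmx2E !mx2E.
- by ring.
- by ring.
- by field.
- by field.
Qed.

(** Moving [diag2 1 z] to the left conjugates [X] by it and completes the first factor to the frame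
    Phi. *)
Lemma frame_factor w (X : 'M[L]_2) :
  mx2 1 0 (lconst w) 1 *m X *m diag2 1 z =
  mx2 1 0 (lconst w) z *m mx2 (X 0 0) (z * X 0 1) (z^-1 * X 1 0) (X 1 1).
Proof.
have z0 := z_neq0 K; move: (lconst w) => w'.
apply: eq_mx2; rewrite !mulmx2E !mx2E.
- by ring.
- by ring.
- by field.
- by field.
Qed.

(** The variation of Phi is [0, 0; a, -b], because z varies by -b. The second column is enough: the
    first row of the variation of the connection is zero, so the trace involves no other entry of
    U. *)
Lemma frame_variationE (a b w : L) (V : 'M[L]_2) :
  let U := (mx2 0 0 a (- b) + mx2 1 0 w z *m V) *m mx2 1 0 (- (w / z)) z^-1 in
  U 0 1 = V 0 1 / z /\ U 1 1 = (w * V 0 1 - b) / z + V 1 1.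
Proof.
have z0 := z_neq0 K; move=> U.
have E k l : (mx2 0 0 a (- b) + mx2 1 0 w z *m V) k l =
  mx2 0 0 a (- b) k l + (mx2 1 0 w z *m V) k l by rewrite [LHS]mxE.
rewrite /U !mulmx2E !E !mulmx2E !mx2E.
by split; [ring | field].
Qed.

(** The upper-right entry [z * u] of the connection vanishes at q_j. Modulo z the second column of
    V' = [V, A] - dA therefore involves only [V 0 1] among the entries of V. *)
Lemma bracketE (a b w u dl ep de h : L) (V : 'M[L]_2) :
  let At := mx2 (w * u) (z * u) ep dl in
  let D := V *m At - At *m V - mx2 (a * u) (- (b * u)) de (h - a * u) in
  D 0 1 = b * u + V 0 1 * (dl - w * u) + z * (u * (V 0 0 - V 1 1)) /\
  D 1 1 = a * u - ep * V 0 1 - h + z * (V 1 0 * u).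
Proof.
move=> At D.
have DE k l : D k l = (V *m At) k l - (At *m V) k l - mx2 (a * u) (- (b * u)) de (h - a * u) k l.
  by rewrite [LHS]mxE [X in X + _]mxE [X in _ + X + _]mxE; congr (_ + _); rewrite [LHS]mxE.
by rewrite !DE !mulmx2E !mx2E; split; ring.
Qed.

(** The product rule for [c0 = z * ep - w * d0 + w ^+ 2 * u], where z varies by [-b], u is constant
    and [d0 = dl + w * u - z^-1]. *)
Lemma c0_variationE (a b w u dl ep de h : L) :
  - b * ep + z * de - (a * (dl + w * u - z^-1) + w * (h - b / z ^+ 2))
    + ((a * w + w * a) * u + w * w * 0) =
  a / z + a * (w * u - dl) - b * ep + z * de - w * (h - b / z ^+ 2).
Proof. by have z0 := z_neq0 K; field. Qed.

End ApparentFrame.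

(** * Variation of the connection and of its solution at q_j *)

Section ApparentSingularity.
Variables (R : realType) (nu : nat) (S : setting R nu).
Local Notation C := (Cx R).
Local Notation L := (laurent C).
Local Notation z := (lvar C).
Variables (F : param S -> nform R nu) (Y : solutions S) (m : param S) (j : 'I_(nq S)).
Hypothesis F_normal : forall m, moduli S m -> is_normal_form m (F m).
Hypothesis m_moduli : moduli S m.
Hypothesis sol : apparent_solution F Y j.
Implicit Types (v : param S).

Local Notation p m' := (lconst (pc j m')).
Local Notation Xq m' := (lconst (qc j m') + z).
Local Notation c0q m' := (c0 (F m') m' (Xq m')).
Local Notation d0q m' := (d0 (F m') m' (Xq m')).

Definition uq (m' : param S) : L := (peval (Ppoly S) (Xq m'))^-1.

(* The regular part of [d0] at [q_j]; its residues at the [t_i] are those of [F m]. *)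
Definition d0reg (m' : param S) : L :=
  \sum_(i < nu) peval (nfD (F m) i) (Xq m') / (Xq m' - lconst (tpos S i)) ^+ pord S (Some i)
  - \sum_(k < nq S | k != j) (Xq m' - lconst (qc k m'))^-1 + peval (nfDinf (F m)) (Xq m').

Definition deltaq (m' : param S) : L := d0reg m' - p m' * uq m'.

Definition epsq (m' : param S) : L :=
  z^-1 * (c0q m' + p m' * d0q m' - p m' ^+ 2 * uq m').

Definition d0reg_var v : L :=
  - \sum_(k < nq S | k != j) lconst ('D_v (qc k) m) * (Xq m - lconst (qc k m))^-1 ^+ 2.

Definition Phiq (m' : param S) : 'M[L]_2 := mx2 1 0 (p m') z.

Definition Atq (m' : param S) : 'M[L]_2 :=
  mx2 (p m' * uq m') (z * uq m') (epsq m') (deltaq m').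

Definition Yq (m' : param S) : 'M[L]_2 :=
  mx2 (Xiq Y m' j 0 0) (z * Xiq Y m' j 0 1) (z^-1 * Xiq Y m' j 1 0) (Xiq Y m' j 1 1).

Lemma d0q_near : \forall m' \near m, d0q m' = d0reg m' - z^-1.
Proof.
apply: filterS (moduli_near m_moduli) => m' m'M.
have [DE DiE] := nfD_polar (F_normal m_moduli) (F_normal m'M) m_moduli m'M.
rewrite /d0 /d0reg DiE (bigD1 j) //=.
under eq_bigr => i _ do rewrite DE.
by rewrite (addrC (lconst (qc j m'))) addrK opprD !addrA -!addrA; congr (_ + _);
  rewrite addrC -!addrA.
Qed.

Lemma gauge_Phiq m' :
  gauge (Phiq m') (Omega_q (F m') m' j) =
  mx2 (p m' * uq m') (z * uq m') (epsq m') (d0q m' + z^-1 - p m' * uq m').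
Proof. exact: gauge_frame. Qed.

Lemma psi_qE m' : psi_q Y j m' = Phiq m' *m Yq m'.
Proof. exact: frame_factor. Qed.

Lemma Xiq_facts m' : moduli S m' ->
  mx_vge 0 (Xiq Y m' j) /\ forall a b, lcoef (Xiq Y m' j a b) 0 = (a == b)%:R.
Proof.
move=> /sol [conv _ X1 _]; split=> a b; first by have [] := conv a b.
by have := congr1 (fun B : 'M_2 => B a b) X1; rewrite !mxE.
Qed.

(** As [Xiq] is the identity at q_j, its lower-left entry vanishes there and absorbs [z^-1]; the
    determinant is that of [Xiq]. *)
Lemma Yq_GL2 m' : moduli S m' -> GL2_series (Yq m').
Proof.
move=> /Xiq_facts [X0 X1]; have z0 := z_neq0 C; split.
  apply: mx_vge2 => //; first by apply: vge0M => //; apply: vge0_z.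
  by apply: vge1_divz; rewrite ?X1.
rewrite det2E !mx2E.
have -> : z * Xiq Y m' j 0 1 * (z^-1 * Xiq Y m' j 1 0) = Xiq Y m' j 0 1 * Xiq Y m' j 1 0.
  by rewrite mulrACA mulfV // mul1r.
by rewrite lcoefB !(lcoefM0 (X0 _ _) (X0 _ _)) !X1 mulr0 subr0 mulr1 oner_neq0.
Qed.

Lemma Yq_ode : \forall m' \near m, dmx (Yq m') = - (Atq m' *m Yq m').
Proof.
apply: filterS2 d0q_near (moduli_near m_moduli) => m' dE /sol [_ _ _].
rewrite psi_qE => /(gauge_horizontal (frame_unit (pc j m'))) ->.
by rewrite gauge_Phiq dE subrK.
Qed.

Lemma Yq_nabla v : exists dY, is_nabla_mx v m (qc j) Yq dY.
Proof.
have Xd a b : exists dX, is_nabla v m (qc j) (fun m' => Xiq Y m' j a b) dX.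
  have [|k|dX XD] := @is_dparam_ex _ _ _ v m (fun m' => Xiq Y m' j a b) 0.
  - by apply: filterS (moduli_near m_moduli) => m' /Xiq_facts [X0 _]; apply: X0.
  - by have [_ d _ _] := sol m_moduli; apply/diff_derivable/d.
  - by eexists; exists dX; first exact: XD.
have [d00 D00] := Xd 0 0; have [d01 D01] := Xd 0 1.
have [d10 D10] := Xd 1 0; have [d11 D11] := Xd 1 1.
eexists; apply: is_nabla_mx2; [exact: D00 | | | exact: D11].
  by apply: is_nablaM (is_nabla_z _ _ _) D01.
by apply: is_nablaM (is_nabla_Vz _ _ _) D10.
Qed.

Lemma derivable_qc v k : derivable (@qc R nu S k) m v.
Proof. exact/diff_derivable/qc_differentiable. Qed.

Lemma derivable_pc v k : derivable (@pc R nu S k) m v.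
Proof. exact/diff_derivable/pc_differentiable. Qed.

Lemma Ppoly_neq0 m' k : moduli S m' -> (Ppoly S).[qc k m'] != 0.
Proof.
move=> [_ qt]; rewrite horner_prod; apply/prodf_neq0 => i _.
rewrite horner_exp !hornerE expf_neq0 // subr_eq0; apply/eqP; exact: qt.
Qed.

Lemma uq_facts m' : moduli S m' ->
  vge 0 (uq m') /\ lcoef (uq m') 0 = ((Ppoly S).[qc j m'])^-1.
Proof.
move=> m'M; have P0 := Ppoly_neq0 j m'M.
have Pv : vge 0 (peval (Ppoly S) (Xq m')) by apply/vge0_peval/vge0_XC.
by split; [apply: vge_inv | rewrite lcoef_inv0]; rewrite ?lcoef0_peval.
Qed.

Lemma uq_nabla v : is_nabla v m (qc j) uq 0.
Proof.
apply: is_nablaV0.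
- by apply: is_nabla_peval; apply: is_nabla_X; apply: derivable_qc.
- by near=> m'; apply/vge0_peval/vge0_XC.
- by apply: filterS (moduli_near m_moduli) => m' /(Ppoly_neq0 j); rewrite lcoef0_peval.
Unshelve. all: by end_near. Qed.

Lemma d0reg_nabla v : is_nabla v m (qc j) d0reg (d0reg_var v).
Proof.
have XD : is_nabla v m (qc j) (fun m' => Xq m') 0 by apply/is_nabla_X/derivable_qc.
have pD P : is_nabla v m (qc j) (fun m' => peval P (Xq m')) 0 by apply: is_nabla_peval.
have fin i : is_nabla v m (qc j) (fun m' => peval (nfD (F m) i) (Xq m') /
    (Xq m' - lconst (tpos S i)) ^+ pord S (Some i)) 0.
  have BD : is_nabla v m (qc j) (fun m' => Xq m' - lconst (tpos S i)) 0.
    exact: is_nabla_eq (is_nablaB XD (is_nabla_cst _ _ _ _)) (subr0 _).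
  have VD : is_nabla v m (qc j) (fun m' => (Xq m' - lconst (tpos S i))^-1) 0.
    apply: is_nablaV0 BD _ _; apply: filterS (moduli_near m_moduli) => m' [_ qt].
      by rewrite XBC; apply: vge0_XC.
    by rewrite XBC lcoef_XC0 subr_eq0; apply/eqP; apply: qt.
  apply: is_nabla_near (is_nabla_eq (is_nablaM (pD (nfD (F m) i)) (is_nabla_exp0 _ VD)) _).
    by near=> m'; rewrite exprVn.
  by rewrite mul0r mulr0 addr0.
have app k : k != j -> is_nabla v m (qc j) (fun m' => (Xq m' - lconst (qc k m'))^-1)
    (lconst ('D_v (qc k) m) * (Xq m - lconst (qc k m))^-1 ^+ 2).
  move=> kj; have BD := is_nablaB XD (@is_nabla_lconst _ _ _ v m (qc j) _ (@derivable_qc v k)).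
  apply: is_nabla_eq (is_nablaV BD _ _) _.
  - by near=> m'; rewrite XBC; apply: vge0_XC.
  - apply: filterS (moduli_near m_moduli) => m' [qq _].
    rewrite XBC lcoef_XC0 subr_eq0; apply/eqP => /qq jk.
    by rewrite jk eqxx in kj.
  - by rewrite sub0r mulNr mulrN opprK mulrAC mulrC expr2.
have fins := @is_nabla_sum _ _ _ v m (qc j) _ (index_enum 'I_nu) xpredT _ _ (fun i _ => fin i).
have apps := @is_nabla_sum _ _ _ v m (qc j) _ (index_enum 'I_(nq S)) _ _ _ app.
apply: is_nabla_eq (is_nablaD (is_nablaB fins apps) (pD (nfDinf (F m)))) _.
by rewrite big1_eq addr0 sub0r.
Unshelve. all: by end_near. Qed.

Lemma deltaq_nabla v :
  is_nabla v m (qc j) deltaq (d0reg_var v - lconst ('D_v (pc j) m) * uq m).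
Proof.
have pD := @is_nabla_lconst _ _ _ v m (qc j) _ (@derivable_pc v j).
apply: is_nabla_eq (is_nablaB (d0reg_nabla v) (is_nablaM pD (uq_nabla v))) _.
by rewrite mulr0 addr0.
Qed.

Lemma vge0_deltaq m' : moduli S m' -> vge 0 (deltaq m').
Proof.
move=> m'M; have [qq qt] := m'M; have [u0 _] := uq_facts m'M.
apply: vgeB; last by apply: vge0M => //; apply: vge_lconst.
apply: vgeD; last exact/vge0_peval/vge0_XC.
apply: vgeB; apply: vge_sum => i ij; first by apply: vge0_fin_term; apply: qt.
by apply: vge0_VXC => /qq ji; rewrite ji eqxx in ij.
Qed.

Lemma vge0_d0reg_var v : vge 0 (d0reg_var v).
Proof.
have [qq _] := m_moduli; apply/vgeN/vge_sum => k kj; apply: vge0M; first exact: vge_lconst.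
by apply/vge0X/vge0_VXC => /qq jk; rewrite jk eqxx in kj.
Qed.

Lemma Yq00 m' : moduli S m' -> vge 0 (Yq m' 0 0) /\ lcoef (Yq m' 0 0) 0 = 1.
Proof. by move=> /Xiq_facts [X0 X1]; rewrite !mx2E; split; [apply: X0 | rewrite X1]. Qed.

(** The entry (1, 0) of the equation of [Yq], solved for [epsq]; the entry [Yq 0 0] is invertible
    since its constant term is 1. Both the holomorphy of [epsq] and its differentiability in the
    parameters come from this formula, the definition through [c0] giving neither. *)
Lemma epsq_near : \forall m' \near m,
  epsq m' = - (lderiv (Yq m' 1 0) + deltaq m' * Yq m' 1 0) * (Yq m' 0 0)^-1.
Proof.
apply: filterS2 Yq_ode (moduli_near m_moduli) => m' ode /Yq00 [_ Y1].
have Y00 : Yq m' 0 0 != 0 by apply: neq0_lcoef0; rewrite Y1 oner_neq0.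
have := congr1 (fun B : 'M_2 => B 1 0) ode.
rewrite mxE [RHS]mxE mulmx2E [Atq m' 1 0]mx2E [Atq m' 1 1]mx2E => ->.
by rewrite opprD opprK addrK mulfK.
Qed.

Lemma vge0_epsq : \forall m' \near m, vge 0 (epsq m').
Proof.
apply: filterS2 epsq_near (moduli_near m_moduli) => m' -> m'M.
have [Y0 Y1] := Yq00 m'M; have [Ys _] := Yq_GL2 m'M.
apply: vge0M; last by apply: vge_inv => //; rewrite Y1 oner_neq0.
apply/vgeN/vgeD; first exact/vge0_deriv/Ys.
by apply: vge0M; [exact: vge0_deltaq | exact: Ys].
Qed.

Lemma epsq_nabla v : exists de, is_nabla v m (qc j) epsq de.
Proof.
have [dY YD] := Yq_nabla v; eexists.
apply: is_nabla_near; first by apply: filterS epsq_near => m' /esym; apply.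
apply: is_nablaM.
  exact: is_nablaN (is_nablaD (is_nabla_deriv (YD 1 0)) (is_nablaM (deltaq_nabla v) (YD 1 0))).
apply: is_nablaV (YD 0 0) _ _; apply: filterS (moduli_near m_moduli) => m' /Yq00 [] //.
by move=> _ ->; rewrite oner_neq0.
Qed.

(** The variations [a], [b], [h] are variables tied by equations, so that the algebraic identities
    apply to them as atoms. *)
Lemma variation_at_q_of v (a b h : L) :
  a = lconst ('D_v (pc j) m) -> b = lconst ('D_v (qc j) m) -> h = d0reg_var v ->
  apparent_variation (p m) (uq m) (deltaq m) (epsq m) a b h
    (dparam_mx_at v m (qc j) (fun m' => Omega_q (F m') m' j))
    (dlog_at v m (qc j) (psi_q Y j)).
Proof.
move=> aE bE hE.
have z0 := z_neq0 C.
have [dY YD] := Yq_nabla v; have [de eD] := epsq_nabla v.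
have pD : is_nabla v m (qc j) (fun m' => p m') a.
  by rewrite aE; apply/is_nabla_lconst/derivable_pc.
have zD : is_nabla v m (qc j) (fun=> z) (- b) by rewrite bE; apply: is_nabla_z.
have uD := uq_nabla v; have dD := deltaq_nabla v; rewrite -aE -hE in dD.
have [u0 _] := uq_facts m_moduli.
have e0 : vge 0 de by apply: is_nabla_vge0 eD vge0_epsq.
have YG := Yq_GL2 m_moduli; have Yu := GL2_series_unit YG.
have dY0 : mx_vge 0 dY.
  move=> k l; apply: is_nabla_vge0 (YD k l) _.
  by apply: filterS (moduli_near m_moduli) => m' /Yq_GL2 [Y0 _]; apply: Y0.
pose N := invmx (Yq m); pose V := dY *m N.
have V0 : mx_vge 0 V by apply: mx_vge0M => //; apply: GL2_series_inv.
have AtD : is_nabla_mx v m (qc j) Atq (mx2 (a * uq m) (- (b * uq m)) de (h - a * uq m)).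
  apply: is_nabla_mx2 => //.
    by apply: is_nabla_eq (is_nablaM pD uD) _; rewrite mulr0 addr0.
  by apply: is_nabla_eq (is_nablaM zD uD) _; rewrite mulr0 addr0 mulNr.
pose dAt := mx2 (a * uq m) (- (b * uq m)) de (h - a * uq m); rewrite -/dAt in AtD.
have dV : dmx V = V *m Atq m - Atq m *m V - dAt.
  have ode := nbhs_singleton Yq_ode.
  (* The equation of [Yq] holds on a neighbourhood of [m] and the derivation with x fixed commutes
     with d/dx, so it can be applied to both sides. *)
  have ddY : dmx dY = - (dAt *m Yq m + Atq m *m dY).
    apply: is_nabla_mx_unique (is_nabla_dmx YD) _.
    apply: is_nabla_mx_near (is_nabla_mxN (is_nabla_mxM AtD YD)).
    by apply: filterS Yq_ode => m' /esym.
  exact: dmx_variation.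
have psiD : is_nabla_mx v m (qc j) (psi_q Y j) (mx2 0 0 a (- b) *m Yq m + Phiq m *m dY).
  apply: is_nabla_mx_near (is_nabla_mxM _ YD) => [|].
    by near=> m'; rewrite psi_qE.
  apply: is_nabla_mx2 => //.
    by rewrite -(rmorph1 (@lconst C)); apply: is_nabla_cst.
  by rewrite -[X in is_nabla _ _ _ (fun=> X)](rmorph0 (@lconst C)); apply: is_nabla_cst.
have UE : dlog_at v m (qc j) (psi_q Y j) =
    (mx2 0 0 a (- b) + Phiq m *m V) *m mx2 1 0 (- (p m / z)) z^-1.
  by rewrite /dlog_at (nabla_mxE psiD) psi_qE mul_variation ?frame_unit // invmx_frame.
have d0D : is_nabla v m (qc j) (fun m' => d0q m') (h - b / z ^+ 2).
  rewrite hE bE; apply: is_nabla_near (is_nablaB (d0reg_nabla v) (is_nabla_Vz v m (qc j))).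
  by apply: filterS d0q_near => m' /esym.
have c0D : is_nabla v m (qc j) (fun m' => c0q m')
    (a / z + a * (p m * uq m - deltaq m) - b * epsq m + z * de - p m * (h - b / z ^+ 2)).
  apply: is_nabla_near (is_nabla_eq (is_nablaD (is_nablaB (is_nablaM zD eD) (is_nablaM pD d0D))
    (is_nablaM (is_nablaM pD pD) uD)) _).
    by near=> m'; rewrite /epsq mulVKf // -expr2 addrAC subrK addrK.
  have dE : d0q m = deltaq m + p m * uq m - z^-1.
    by rewrite (nbhs_singleton d0q_near) /deltaq subrK.
  by rewrite dE; apply: c0_variationE.
have OD : is_nabla_mx v m (qc j) (fun m' => Omega_q (F m') m' j)
    (mx2 0 0 (a / z + a * (p m * uq m - deltaq m) - b * epsq m + z * de - p m * (h - b / z ^+ 2))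
         (h - b / z ^+ 2)).
  apply: is_nabla_mx2 => //.
  by rewrite -[X in is_nabla _ _ _ (fun=> X)](rmorph0 (@lconst C)); apply: is_nabla_cst.
have [U01 U11] := frame_variationE a b (p m) V; rewrite -UE in U01 U11.
have [D01 D11] := bracketE a b (p m) (uq m) (deltaq m) (epsq m) de h V.
exists (V 0 1), (V 1 1), de, (uq m * (V 0 0 - V 1 1)), (V 1 0 * uq m); split.
- split=> //; apply: vge0M => //; apply: vgeB; exact: V0.
- have dVE k l : lderiv (V k l) = (V *m Atq m - Atq m *m V - dAt) k l by rewrite -dV [RHS]mxE.
  by rewrite !dVE.
- by [].
- by rewrite (nabla_mxE OD) !mx2E.
- by rewrite (nabla_mxE OD) !mx2E.
Unshelve. all: by end_near. Qed.

End ApparentSingularity.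

(** * Comparison with the wedge products and summation over j *)

Section Total.
Variables (R : realType) (nu : nat) (S : setting R nu).
Local Notation C := (Cx R).
Local Notation L := (laurent C).
Local Notation z := (lvar C).
Variables (F : param S -> nform R nu) (Y : solutions S) (m : param S).
Hypothesis F_normal : forall m, moduli S m -> is_normal_form m (F m).
Hypothesis m_moduli : moduli S m.
Implicit Types (v : param S).

Lemma lcoef0_d0reg_var v (j : 'I_(nq S)) : lcoef (d0reg_var m j v) 0 =
  - \sum_(k < nq S | k != j) 'D_v (qc k) m * (qc j m - qc k m) ^- 2.
Proof.
have [qq _] := m_moduli.
rewrite lcoefN lcoef_sum; congr (- _); apply: eq_bigr => k kj.
have jk : qc j m <> qc k m by move=> /qq jk; rewrite jk eqxx in kj.
have XV := vge0_VXC jk.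
rewrite lcoef_lconstM expr2 (lcoefM0 XV XV) XBC lcoef_inv0 ?lcoef_XC0 ?subr_eq0 //.
- by rewrite expr2 invfM.
- exact: vge0_XC.
- exact/eqP.
Qed.

(** With x fixed 1/P(x) does not vary, so its constant coefficient at the moving centre q_j varies
    by the variation of q_j times the derivative in x. The term in [u'] is a multiple of the
    variation of q_j and drops out of the wedge product with dq_j. *)
Lemma derive_pc_Ppoly v (j : 'I_(nq S)) :
  let u' := lcoef (lderiv (uq j m)) 0 in
  'D_v (fun m' => pc j m' / (Ppoly S).[qc j m']) m =
  pc j m * ('D_v (qc j) m * u') + ((Ppoly S).[qc j m])^-1 * 'D_v (pc j) m.
Proof.
move=> u'; have [du [_ uD] duE] := uq_nabla j m_moduli v.
have {}uD : is_derive m v (fun m' => ((Ppoly S).[qc j m'])^-1) ('D_v (qc j) m * u').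
  have -> : 'D_v (qc j) m * u' = lcoef du 0.
    move/eqP: duE; rewrite eq_sym subr_eq0 => /eqP ->.
    by rewrite lcoef_lconstM.
  apply: near_eq_is_derive (uD 0).
  by apply: filterS (moduli_near m_moduli) => m' m'M; have [_ ->] := uq_facts j m'M.
have pD := derivableP (@derivable_pc _ _ _ m v j).
by have [_ ->] := is_deriveM pD uD.
Qed.

Lemma antisym_sum_eq0 (K : numFieldType) n (T : 'I_n -> 'I_n -> K) :
  (forall j k, T j k = - T k j) -> \sum_(j < n) \sum_(k < n | k != j) T j k = 0.
Proof.
move=> Tanti; have -> : \sum_(j < n) \sum_(k < n | k != j) T j k = \sum_(j < n) \sum_(k < n) T j k.
  apply: eq_bigr => j _; rewrite [RHS](bigD1 j) //=.
  have /eqP := Tanti j j; rewrite -subr_eq0 opprK -mulr2n mulrn_eq0 /= => /eqP ->.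
  by rewrite add0r.
have : (\sum_(j < n) \sum_(k < n) T j k) *+ 2 = 0.
  rewrite mulr2n {1}exchange_big /= -big_split big1 // => j _.
  by rewrite -big_split big1 // => k _; rewrite /= Tanti addNr.
by move/eqP; rewrite mulrn_eq0 => /eqP.
Qed.

Lemma wedge_eq (K : comPzRingType) (P p' u' a1 a2 b1 b2 : K) :
  (p' * (b1 * u') + P * a1) * b2 - (p' * (b2 * u') + P * a2) * b1 = (a1 * b2 - a2 * b1) * P.
Proof. by ring. Qed.

Lemma dwedge_pc_Ppoly v1 v2 (j : 'I_(nq S)) :
  dwedge (fun m' => pc j m' / (Ppoly S).[qc j m']) (qc j) m v1 v2 =
  ('D_v1 (pc j) m * 'D_v2 (qc j) m - 'D_v2 (pc j) m * 'D_v1 (qc j) m) * ((Ppoly S).[qc j m])^-1.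
Proof.
by rewrite /dwedge (derive_pc_Ppoly v1 j) (derive_pc_Ppoly v2 j) wedge_eq.
Qed.

Lemma cross_term_anti (K : fieldType) (q1 q2 a1 a2 b1 b2 : K) :
  (b1 * a2 - a1 * b2) * (q1 - q2) ^- 2 = - ((b2 * a1 - a2 * b1) * (q2 - q1) ^- 2).
Proof.
by rewrite -(opprB q1) sqrrN -[RHS]mulNr opprB [b2 * _]mulrC [a2 * _]mulrC.
Qed.

Lemma cross_termsE (K : comPzRingType) n (j : 'I_n) (w b1 b2 : K) (d1 d2 c : 'I_n -> K) :
  w + b1 * (- \sum_(k < n | k != j) d2 k * c k) - b2 * (- \sum_(k < n | k != j) d1 k * c k) =
  w + \sum_(k < n | k != j) (b2 * d1 k - b1 * d2 k) * c k.
Proof.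
rewrite !mulrN opprK -addrA; congr (_ + _); rewrite !mulr_sumr addrC -sumrB.
by apply: eq_bigr => k _; rewrite mulrBl !mulrA.
Qed.

Lemma res_apparentE v1 v2 (j : 'I_(nq S)) : apparent_solution F Y j ->
  let A := fun m' => Omega_q (F m') m' j in
  res_tr_wedge (dparam_mx_at v1 m (qc j) A) (dparam_mx_at v2 m (qc j) A)
    (dlog_at v1 m (qc j) (psi_q Y j)) (dlog_at v2 m (qc j) (psi_q Y j)) =
  2%:R * (dwedge (fun m' => pc j m' / (Ppoly S).[qc j m']) (qc j) m v1 v2
    + \sum_(k < nq S | k != j) ('D_v2 (qc j) m * 'D_v1 (qc k) m - 'D_v1 (qc j) m * 'D_v2 (qc k) m)
        * (qc j m - qc k m) ^- 2).
Proof.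
move=> sol A; rewrite /res_tr_wedge.
have var v := variation_at_q_of F_normal m_moduli sol (erefl _) (erefl _) (erefl (d0reg_var m j v)).
have h0 v := vge0_d0reg_var j m_moduli v.
rewrite (apparent_residue (h0 v1) (h0 v2) (var v1) (var v2)).
have [_ ->] := uq_facts j m_moduli.
rewrite (dwedge_pc_Ppoly v1 v2 j).
pose h v := - \sum_(k < nq S | k != j) 'D_v (qc k) m * (qc j m - qc k m) ^- 2.
have hE v : lcoef (d0reg_var m j v) 0 = h v := lcoef0_d0reg_var v j.
pose w := ('D_v1 (pc j) m * 'D_v2 (qc j) m - 'D_v2 (pc j) m * 'D_v1 (qc j) m)
  * ((Ppoly S).[qc j m])^-1.
transitivity (2%:R * (w + 'D_v1 (qc j) m * h v2 - 'D_v2 (qc j) m * h v1)).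
  by congr (_ * (_ + _ * _ - _ * _)); apply: hE.
exact: (congr1 (fun x => 2%:R * x) (cross_termsE j w ('D_v1 (qc j) m) ('D_v2 (qc j) m)
  (fun k => 'D_v1 (qc k) m) (fun k => 'D_v2 (qc k) m) (fun k => (qc j m - qc k m) ^- 2))).
Qed.

End Total.

Theorem theorem4p4 (R : realType) (nu : nat) (S : setting R nu)
    (F : param S -> nform R nu) (Y : solutions S)
    (HF : forall m, moduli S m -> is_normal_form m (F m))
    (Hunr : forall i, kind S i <> Ramified -> unramified_solution F Y i)
    (Hram : forall i, kind S i = Ramified -> ramified_solution F Y i)
    (Hq : forall j, apparent_solution F Y j)
    (m : param S) (Hm : moduli S m) (v1 v2 : param S) :
  omega F Y m v1 v2 =
  \sum_(j < nq S)
    dwedge (fun m' => pc j m' / (Ppoly S).[qc j m']) (qc j) m v1 v2.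
Proof.
pose d j := dwedge (fun m' => pc j m' / (Ppoly S).[qc j m']) (qc j) m v1 v2.
pose t (j k : 'I_(nq S)) := ('D_v2 (qc j) m * 'D_v1 (qc k) m - 'D_v1 (qc j) m * 'D_v2 (qc k) m)
  * (qc j m - qc k m) ^- 2.
transitivity (2%:R^-1 * 0 + 4%:R^-1 * 0
    + 2%:R^-1 * \sum_(j < nq S) 2%:R * (d j + \sum_(k < nq S | k != j) t j k)).
  rewrite /omega; congr (_ * _ + _ * _ + _ * _).
  - apply: big1 => i ki; apply: res_unramified_eq0 => //.
    by apply: Hunr => kr; rewrite kr in ki.
  - apply: big1 => i ki; apply: res_ramified_eq0 => //.
    by apply: Hram; case: (kind S i) ki.
  - by apply: eq_bigr => j _; exact: (res_apparentE HF Hm v1 v2 (Hq j)).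
have t0 : \sum_(j < nq S) \sum_(k < nq S | k != j) t j k = 0.
  by apply: antisym_sum_eq0 => j k; apply: cross_term_anti.
by rewrite !mulr0 !add0r -mulr_sumr mulKf ?pnatr_eq0 // big_split /= t0 addr0.
Qed.
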